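(* Let $S(p)$ be an algebraic sail of some simplicial cone in $\mathbb{R}^3$, and let $\pi$ be a proper projection plane for $S(p)$. \begin{enumerate} \item The projective lifting coefficients of $\omega_S$ are rational numbers that simultaneously have the same sign. \item The projective lifting coefficients of $\omega_S$ are doubly periodic. \item If $\pi$ is an integer plane, then the projection-framework $G_S(\bar p)$ is rational and $\bar \omega_S$ is proportional to some integer self-stress. \end{enumerate}
   Context: For a simplicial cone $\mathcal{C}$ in $\mathbb{R}^3$ (convex hull of rays $Ox_1,Ox_2,Ox_3$ from the origin $O$ through linearly independent vectors), the sail is the boundary of the convex hull of all integer points of $\mathcal{C}$ other than $O$. For a matrix $A\in \mathrm{GL}(3,\mathbb{R})$ with distinct positive real eigenvalues, the eigenspaces give $2^3$ simplicial cones whose sails form the continued fraction of $A$ (in the sense of Klein); if $A\in\mathrm{GL}(3,\mathbb{Z})$ the sails are called algebraic. The positive Dirichlet group of $A$ (integer matrices commuting with $A$ with positive real eigenvalues) is isomorphic to $\mathbb{Z}^2$, preserves the sails and acts on them, so algebraic sails are combinatorially doubly periodic. The sail $S(p)$ is an oriented convex polyhedral surface with vertices $p_i$. For points $p_1,\dots,p_4\in\mathbb{R}^3$ with ${\rm span}(p_1,p_2,p_3)$ and ${\rm span}(p_1,p_2,p_4)$ two-dimensional and not through $O$, the projective lifting coefficient is $\omega(p_1,p_2;p_3,p_4)=\frac{\det(p_2-p_1,p_3-p_1,p_4-p_1)}{\det(p_1,p_2,p_3)\det(p_1,p_2,p_4)}$. For an oriented edge $p_ip_j$ of $S(p)$,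 with $p_k$ a point on the right adjacent face and $p_l$ a point on the left adjacent face, $\omega_{ij}=\omega(p_i,p_j;p_k,p_l)$, and $\omega_S$ is the collection of these. A proper projection plane $\pi$ is an affine plane not containing $O$ such that no line ${\rm span}(O,p_i)$ is parallel to $\pi$. The projection-framework $G_S(\bar p)$ has vertices $\bar p_i={\rm span}(O,p_i)\cap\pi$ and edges $\bar p_i\bar p_j$ for edges $p_ip_j$ of $S(p)$; the projection-coefficients $\beta_i$ are given by $p_i-O=\beta_i(\bar p_i-O)$, and the projection-stress $\bar\omega_S$ has coefficients $\bar\omega_{ij}=\beta_i\beta_j\omega_{ij}$, which is a self-stress of $G_S(\bar p)$. A framework is rational if all vertices have rational coordinates; a self-stress is integer if all its coefficients are integers. An integer plane is one containing a full-rank integer sublattice.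
   Formalization: The characteristic polynomial of A is additionally assumed irreducible over Q; otherwise (eigenvalues 1, λ, 1/λ) the positive Dirichlet group has rank 1, a face of the hull lies in a plane through O, and the lifting coefficients are undefined there. *)

(* Defs.v *)
From HB Require Import structures.
From mathcomp Require Import all_boot all_order all_algebra.
From mathcomp Require Import reals.
Set Implicit Arguments. Unset Strict Implicit. Unset Printing Implicit Defensive.
Import Order.TTheory GRing.Theory Num.Theory.
Local Open Scope ring_scope.

Section Sail.
Variable R : realType.
Notation vec := 'cV[R]_3.

Definition dot (u v : vec) : R := (u^T *m v) 0 0.
Definition det3 (u v w : vec) : R :=
  \det (\matrix_(i < 3, j < 3) nth 0 [:: u i 0; v i 0; w i 0] j).

Definition is_rat (x : R) : Prop := exists q : rat, x = ratr q.
Definition int_pt (x : vec) : Prop := forall i, x i 0 \is a Num.int.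
Definition rat_pt (x : vec) : Prop := forall i, is_rat (x i 0).

Definition cone (v1 v2 v3 : vec) (x : vec) : Prop :=
  exists a1 a2 a3 : R, [/\ 0 <= a1, 0 <= a2, 0 <= a3 &
                           x = a1 *: v1 + a2 *: v2 + a3 *: v3].

Definition conv (S : vec -> Prop) (x : vec) : Prop :=
  exists (n : nat) (pt : 'I_n -> vec) (w : 'I_n -> R),
    [/\ forall i, S (pt i), forall i, 0 <= w i, \sum_i w i = 1 &
        x = \sum_i w i *: pt i].

(* K = convex hull of the integer points of the cone other than O;
   the sail is the boundary of K *)
Definition klein_hull (v1 v2 v3 : vec) : vec -> Prop :=
  conv (fun x => [/\ int_pt x, cone v1 v2 v3 x & x != 0]).

Definition exposed (K : vec -> Prop) (n : vec) (x : vec) : Prop :=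
  K x /\ forall y, K y -> dot n y <= dot n x.

Definition lin_indep2 (u v : vec) : Prop :=
  forall a b : R, a *: u + b *: v = 0 -> a = 0 /\ b = 0.

Definition face2 (K : vec -> Prop) (n : vec) : Prop :=
  n != 0 /\ exists x y z, [/\ exposed K n x, exposed K n y, exposed K n z &
                              lin_indep2 (y - x) (z - x)].

Definition segment (a b : vec) (x : vec) : Prop :=
  exists t : R, [/\ 0 <= t, t <= 1 & x = a + t *: (b - a)].

Definition on_line (a b : vec) (x : vec) : Prop :=
  exists t : R, x = a + t *: (b - a).

(* (a, b, k, l) : a b is an oriented edge of the sail (the common edge of two
   distinct faces), k is a point of the face on the right of a->b and l a point
   of the face on the left of a->b (not on the line a b), where right/left is
   seen from outside K (the side towards which the outward normals point). *)
Definition edge_datum (K : vec -> Prop) (a b k l : vec) : Prop :=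
  a != b /\
  exists n1 n2 : vec,
    [/\ face2 K n1, face2 K n2,
        (forall x, (exposed K n1 x /\ exposed K n2 x) <-> segment a b x),
        [/\ exposed K n1 k, ~ on_line a b k & det3 (b - a) (k - a) n1 < 0] &
        [/\ exposed K n2 l, ~ on_line a b l & 0 < det3 (b - a) (l - a) n2]].

Definition is_edge (K : vec -> Prop) (a b : vec) : Prop :=
  exists k l, edge_datum K a b k l.

Definition is_vertex (K : vec -> Prop) (p : vec) : Prop :=
  K p /\ exists n : vec, forall y, K y -> y != p -> dot n y < dot n p.

Definition omega (p1 p2 p3 p4 : vec) : R :=
  det3 (p2 - p1) (p3 - p1) (p4 - p1) / (det3 p1 p2 p3 * det3 p1 p2 p4).

(* the affine plane pi = {x | dot c x = d}; it avoids O iff d != 0 *)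
Definition proper_plane (K : vec -> Prop) (c : vec) (d : R) : Prop :=
  [/\ c != 0, d != 0 & forall p, is_vertex K p -> dot c p != 0].

Definition integer_plane (c : vec) (d : R) : Prop :=
  exists p0 u v : vec, [/\ int_pt p0, int_pt u, int_pt v, lin_indep2 u v &
     forall a b : int, dot c (p0 + a%:~R *: u + b%:~R *: v) = d].

(* projection to pi: bar p = span(O,p) cap pi, and p = beta * bar p *)
Definition proj_pt (c : vec) (d : R) (p : vec) : vec := (d / dot c p) *: p.
Definition proj_coef (c : vec) (d : R) (p : vec) : R := dot c p / d.

(* s is a self-stress of the framework with edges those of the sail and
   vertex positions pbar (each vertex has finitely many neighbours) *)
Definition self_stress (K : vec -> Prop) (pbar : vec -> vec)
    (s : vec -> vec -> R) : Prop :=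
  (forall a b, is_edge K a b -> s a b = s b a) /\
  forall a, exists ns : seq vec,
    [/\ uniq ns, (forall b, b \in ns <-> is_edge K a b) &
        \sum_(b <- ns) s a b *: (pbar b - pbar a) = 0].

End Sail.

Definition ZtoQ (M : 'M[int]_3) : 'M[rat]_3 := map_mx (fun z : int => z%:~R) M.
Definition ZtoR (R : realType) (M : 'M[int]_3) : 'M[R]_3 :=
  map_mx (fun z : int => z%:~R) M.

Definition pos_dirichlet (R : realType) (A B : 'M[int]_3) : Prop :=
  [/\ B \in unitmx, B * A = A * B &
      exists m1 m2 m3 : R, [/\ 0 < m1, 0 < m2, 0 < m3 &
        char_poly (ZtoR R B) = ('X - m1%:P) * ('X - m2%:P) * ('X - m3%:P)]].

(* Main.v *)
(* Let S be the set of nonzero integer points of the cone and scale the inner normal N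
   of each face so that N = 1 on the face and N >= 1 on S.  If N1 and N2 are the normals
   of the right and left faces of an edge ab, then N1 - N2 = omega(a,b) (a x b).  Hence
   omega depends only on integer points, so it is rational, and it is negative by
   convexity.  Every face at a vertex a has exactly two edges at a, one with the face on
   its right and one with the face on its left, so the sum of omega(a,b) (a x b) over the
   neighbours b of a telescopes to 0; projecting to the plane, this is the equilibrium of
   the stress.

   The arithmetic input is Dirichlet's unit theorem for Z[A].  It provides two independent
   elements of the positive Dirichlet group, the local finiteness of the sail (through
   units contracting two of the three eigendirections), and finitely many edges up to
   units, hence a common denominator for all the coefficients. *)
Require Import Defs.
From HB Require Import structures.
From mathcomp Require Import all_boot all_order all_algebra.
From mathcomp Require Import reals.
From mathcomp Require Import boolp classical_sets.
From mathcomp Require Import ring lra zify.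
Set Implicit Arguments. Unset Strict Implicit. Unset Printing Implicit Defensive.
Import Order.TTheory GRing.Theory Num.Theory.
Local Open Scope ring_scope.

(** * Vectors in dimension three *)

(** At the start [K] is only a convex hull: that a face has two edges at each vertex and that an
    edge bounds two faces has to be derived. The geometry is therefore carried by flags, a face
    normal together with one edge and a side, described through points of S alone. A flag can be
    turned about [a] inside its face or rotated about its edge into the neighbouring face. Both
    moves select an extremal point of S, which exists because the bound behind local finiteness is
    uniform over all supporting normals at [a]. Irreducibility of the characteristic polynomial
    enters through [sig_eq0]: a nonzero element of Z[A] has no zero embedding, so its norm is a
    nonzero integer. This lower bound is what turns the one-sided estimates of the box principle
    into two-sided ones. Units arise as quotients of elements of equal norm; their eigenvalues may
    be negative, so they get squared. *)

Notation i2 := (@Ordinal 3 2 isT).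

Lemma ord3P (P : 'I_3 -> Prop) : P 0 -> P 1 -> P i2 -> forall i, P i.
Proof.
move=> h0 h1 h2 [[|[|[|//]]] h].
- by rewrite (_ : Ordinal h = 0) //; apply/val_inj.
- by rewrite (_ : Ordinal h = 1) //; apply/val_inj.
- by rewrite (_ : Ordinal h = i2) //; apply/val_inj.
Qed.

Lemma sum3E (V : nmodType) (f : 'I_3 -> V) : \sum_i f i = f 0 + f 1 + f i2.
Proof.
rewrite !big_ord_recl big_ord0 addr0 addrA.
by congr (_ + f _ + f _); apply/val_inj.
Qed.

Section Vec.
Variable R : realType.
Notation vec := 'cV[R]_3.
Implicit Types (u v w x y z a b k l N n : vec).

Definition cross u v : vec :=
  \col_i nth 0 [:: u 1 0 * v i2 0 - u i2 0 * v 1 0;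
                   u i2 0 * v 0 0 - u 0 0 * v i2 0;
                   u 0 0 * v 1 0 - u 1 0 * v 0 0] i.

Lemma vecP u v : u 0 0 = v 0 0 -> u 1 0 = v 1 0 -> u i2 0 = v i2 0 -> u = v.
Proof. by move=> h0 h1 h2; apply/colP; apply: ord3P. Qed.

Lemma dotE u v : dot u v = u 0 0 * v 0 0 + u 1 0 * v 1 0 + u i2 0 * v i2 0.
Proof. by rewrite /dot mxE sum3E !mxE. Qed.

Lemma crossE u v : (cross u v 0 0 = u 1 0 * v i2 0 - u i2 0 * v 1 0) *
  (cross u v 1 0 = u i2 0 * v 0 0 - u 0 0 * v i2 0) *
  (cross u v i2 0 = u 0 0 * v 1 0 - u 1 0 * v 0 0).
Proof. by rewrite !mxE. Qed.

(** The entries are indexed by [nat] so that the shifted indices of the minors reduce by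
    computation. *)
Lemma det_mx33 (F : nat -> nat -> R) : \det (\matrix_(i < 3, j < 3) F i j) =
  F 0%N 0%N * (F 1%N 1%N * F 2%N 2%N - F 1%N 2%N * F 2%N 1%N) - F 0%N 1%N * (F 1%N 0%N * F 2%N 2%N - F 1%N 2%N * F 2%N 0%N)
  + F 0%N 2%N * (F 1%N 0%N * F 2%N 1%N - F 1%N 1%N * F 2%N 0%N).
Proof.
rewrite (expand_det_row _ ord0) sum3E /cofactor !(expand_det_row _ ord0).
rewrite !big_ord_recl !big_ord0 /cofactor !det_mx11 !mxE /= /bump /=; ring.
Qed.

Lemma det3E u v w : det3 u v w = dot (cross u v) w.
Proof.
pose F i j := nth 0 [:: u (inord i) 0; v (inord i) 0; w (inord i) 0] j.
rewrite /det3 (_ : \matrix_(i, j) _ = \matrix_(i, j) F i j); last first.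
  by apply/matrixP => i j; rewrite !mxE /F !inord_val.
have h0 : inord 0 = 0 :> 'I_3 by apply/val_inj; rewrite /= inordK.
have h1 : inord 1 = 1 :> 'I_3 by apply/val_inj; rewrite /= inordK.
have h2 : inord 2 = i2 by apply/val_inj; rewrite /= inordK.
rewrite det_mx33 /F /= h0 h1 h2 dotE !crossE; ring.
Qed.

Definition vE := (det3E, dotE, crossE, mxE).

Lemma dotDl u v w : dot (u + v) w = dot u w + dot v w.
Proof. by rewrite !vE; ring. Qed.
Lemma dotBl u v w : dot (u - v) w = dot u w - dot v w.
Proof. by rewrite !vE; ring. Qed.
Lemma dotNl u w : dot (- u) w = - dot u w.
Proof. by rewrite !vE; ring. Qed.
Lemma dotZl r u w : dot (r *: u) w = r * dot u w.
Proof. by rewrite !vE; ring. Qed.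
Lemma dotDr u v w : dot w (u + v) = dot w u + dot w v.
Proof. by rewrite !vE; ring. Qed.
Lemma dotBr u v w : dot w (u - v) = dot w u - dot w v.
Proof. by rewrite !vE; ring. Qed.
Lemma dotNr u w : dot w (- u) = - dot w u.
Proof. by rewrite !vE; ring. Qed.
Lemma dotZr r u w : dot w (r *: u) = r * dot w u.
Proof. by rewrite !vE; ring. Qed.
Lemma dot_sumr I (s : seq I) (f : I -> vec) w :
  dot w (\sum_(i <- s) f i) = \sum_(i <- s) dot w (f i).
Proof. by rewrite /dot mulmx_sumr summxE. Qed.

Definition dotL := (dotDl, dotBl, dotNl, dotZl, dotDr, dotBr, dotNr, dotZr).

Lemma dot_self_ge0 u : 0 <= dot u u.
Proof. by rewrite dotE -!expr2 !addr_ge0 ?sqr_ge0. Qed.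

Lemma dot_self_eq0 u : dot u u = 0 -> u = 0.
Proof.
rewrite dotE -!expr2 => h.
have [h1 [h2 h3]] : u 0 0 ^+ 2 = 0 /\ u 1 0 ^+ 2 = 0 /\ u i2 0 ^+ 2 = 0.
  by move: (sqr_ge0 (u 0 0)) (sqr_ge0 (u 1 0)) (sqr_ge0 (u i2 0)); lra.
by apply: vecP; rewrite mxE; apply/eqP; rewrite -sqrf_eq0 ?h1 ?h2 ?h3.
Qed.

Lemma dot_self_gt0 u : u != 0 -> 0 < dot u u.
Proof.
move=> u0; rewrite lt_def dot_self_ge0 andbT.
by apply: contra u0 => /eqP/dot_self_eq0 ->.
Qed.

Lemma cross_eq0 u v : u != 0 -> cross u v = 0 -> exists t, v = t *: u.
Proof.
move=> u0 h; exists (dot u v / dot u u).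
have {u0} d0 : dot u u != 0 by rewrite gt_eqF ?dot_self_gt0.
have E : dot u u *: v = dot u v *: u.
  suff : dot u u *: v - dot u v *: u = cross (cross u v) u.
    rewrite h => /eqP; rewrite subr_eq (_ : cross 0 u = 0) ?add0r => [/eqP|] //.
    by apply: vecP; rewrite !vE; ring.
  by apply: vecP; rewrite !vE; ring.
by apply: (scalerI d0); rewrite E scalerA mulrCA divff ?mulr1.
Qed.

Lemma plane_line N a b x : a != b -> dot N a = 1 -> dot N b = 1 ->
  dot N x = 1 -> det3 a b x = 0 -> exists t, x = a + t *: (b - a).
Proof.
move=> ab Na Nb Nx D.
have : exists t, x - a = t *: (b - a); last first.
  by move=> [t e]; exists t; rewrite -e addrC subrK.
apply: cross_eq0; first by rewrite subr_eq0 eq_sym.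
(* N x (a x b) = a (N.b) - b (N.a) = a - b, so both N and a x b kill x - a *)
have -> : cross (b - a) (x - a) = dot (cross a b) (x - a) *: N - dot N (x - a) *: cross a b
   + cross ((b - a) - (dot N a *: b - dot N b *: a)) (x - a).
  by apply: vecP; rewrite !vE; ring.
rewrite Na Nb !scale1r subrr !dotBr Na Nx -det3E D.
by apply: vecP; rewrite !vE; ring.
Qed.

(** [N - N'] kills [a] and [b], hence is a multiple of their cross product; evaluation at [k] gives
    the factor. *)
Lemma dot_basis N N' a b k : det3 a b k != 0 -> dot N a = dot N' a -> dot N b = dot N' b ->
  N - N' = ((dot N k - dot N' k) / det3 a b k) *: cross a b.
Proof.
move=> D ha hb; apply: (scalerI D); rewrite scalerA mulrC divfK //.
have -> : det3 a b k *: (N - N') = (dot N a - dot N' a) *: cross b k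
  + (dot N b - dot N' b) *: cross k a + (dot N k - dot N' k) *: cross a b.
  by apply: vecP; rewrite !vE; ring.
by rewrite ha hb !subrr !scale0r !add0r.
Qed.

(** Up to the determinant, [cross b k], [cross k a], [cross a b] is the basis dual to [a], [b],
    [k]. *)
Lemma det3_normal N a b k : dot N a = 1 -> dot N b = 1 -> dot N k = 1 ->
  det3 a b k *: N = cross (b - a) (k - a).
Proof.
move=> Na Nb Nk.
have -> : det3 a b k *: N = dot N a *: cross b k + dot N b *: cross k a + dot N k *: cross a b.
  by apply: vecP; rewrite !vE; ring.
by rewrite Na Nb Nk !scale1r; apply: vecP; rewrite !vE; ring.
Qed.

(** Once both denominators are cleared, [det3_normal] turns the normals into cross products of
    differences and a polynomial identity remains. *)
Lemma omega_normals N1 N2 a b k l :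
  dot N1 a = 1 -> dot N1 b = 1 -> dot N1 k = 1 ->
  dot N2 a = 1 -> dot N2 b = 1 -> dot N2 l = 1 ->
  det3 a b k != 0 -> det3 a b l != 0 ->
  N1 - N2 = omega a b k l *: cross a b.
Proof.
move=> N1a N1b N1k N2a N2b N2l Dk Dl.
have e1 := det3_normal N1a N1b N1k; have e2 := det3_normal N2a N2b N2l.
apply: (scalerI (mulf_neq0 Dk Dl)); rewrite scalerA /omega mulrCA divff ?mulr1 ?mulf_neq0 //.
rewrite scalerBr {1}(mulrC (det3 a b k)) -!scalerA e1 e2.
by apply: vecP; rewrite !vE; ring.
Qed.

Lemma omegaC a b k l : omega b a l k = omega a b k l.
Proof.
rewrite /omega mulrC [RHS]mulrC; congr (_^-1 * _); last by rewrite !vE; ring.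
by rewrite !vE; ring.
Qed.

Lemma det3_mul (M : 'M[R]_3) u v w :
  det3 (M *m u) (M *m v) (M *m w) = \det M * det3 u v w.
Proof.
rewrite /det3 -det_mulmx; congr (\det _); apply/matrixP => i.
by apply: ord3P; rewrite !mxE; apply: eq_bigr => j _; rewrite !mxE.
Qed.

Lemma dot_mull (M : 'M[R]_3) u v : dot (M^T *m u) v = dot u (M *m v).
Proof. by rewrite /dot trmx_mul trmxK mulmxA. Qed.

End Vec.

(** * Convex hulls *)

Lemma seq_argmin (R : realDomainType) (T : eqType) (P : T -> Prop) (f : T -> R) (s : seq T) :
  (exists2 x, x \in s & P x) ->
  exists x, [/\ x \in s, P x & forall y, y \in s -> P y -> f x <= f y].
Proof.
elim: s => [[x]|z s IH ex]; first by rewrite in_nil.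
have [/IH [x [xs Px xmin]]|no] := pselect (exists2 x, x \in s & P x).
  have [[Pz zx]|h] := pselect (P z /\ f z <= f x).
    exists z; split; rewrite ?mem_head // => y; rewrite inE => /predU1P[->//|ys Py].
    exact: le_trans zx (xmin y ys Py).
  exists x; split; rewrite ?inE ?xs ?orbT // => y /predU1P[->|ys] Py; last exact: xmin.
  by rewrite leNgt; apply/negP => /ltW zx; apply: h.
exists z; split; rewrite ?mem_head //.
  by case: ex => x; rewrite inE => /predU1P[->//|xs Px]; case: no; exists x.
by move=> y; rewrite inE => /predU1P[->//|ys Py]; case: no; exists y.
Qed.

Section Conv.
Variable R : realType.
Notation vec := 'cV[R]_3.
Implicit Types (S : vec -> Prop) (x y a b n : vec).

Lemma conv_sub S x : S x -> conv S x.
Proof.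
move=> Sx; exists 1%N, (fun=> x), (fun=> 1).
by split; rewrite ?big_ord1 ?scale1r // => _; exact: ler01.
Qed.

Lemma conv_mono S S' x : (forall y, S y -> S' y) -> conv S x -> conv S' x.
Proof. by move=> h [n [pt [w [Spt w0 w1 ->]]]]; exists n, pt, w; split=> // i; apply: h. Qed.

Lemma conv_ge S n c x : conv S x -> (forall y, S y -> c <= dot n y) -> c <= dot n x.
Proof.
move=> [m [pt [w [Spt w0 w1 ->]]]] h; rewrite dot_sumr -[c]mul1r -w1 mulr_suml.
by apply: ler_sum => i _; rewrite dotZr ler_wpM2l ?h.
Qed.

(** A weighted mean that equals a lower bound forces every point of nonzero weight onto that
    bound. *)
Lemma conv_face S n c x : conv S x -> (forall y, S y -> c <= dot n y) -> dot n x = c ->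
  conv (fun y => S y /\ dot n y = c) x.
Proof.
move=> [m [pt [w [Spt w0 w1 ex]]]] h nx.
have /existsP[i0 wi0] : [exists i, w i != 0].
  apply: contra_eqT w1 => /existsPn w00; rewrite big1 1?eq_sym ?oner_eq0 // => i _.
  by apply/eqP; rewrite -[_ == _]negbK w00.
have eqc i : w i != 0 -> dot n (pt i) = c.
  have : \sum_i w i * (dot n (pt i) - c) = 0.
    under eq_bigr do rewrite mulrBr -dotZr.
    by rewrite sumrB -mulr_suml w1 mul1r -dot_sumr -ex nx subrr.
  move=> sum0 wi; apply/eqP; rewrite -subr_eq0.
  have ge0 j : true -> 0 <= w j * (dot n (pt j) - c) by rewrite mulr_ge0 // subr_ge0 h.
  have /eqP := psumr_eq0P ge0 sum0 (i:=i) isT.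
  by rewrite mulf_eq0 (negPf wi).
(* Points of weight zero may lie off the face, so they are replaced by one of nonzero weight. *)
exists m, (fun i => if w i == 0 then pt i0 else pt i), w; split => // [i|].
  by case: ifP => [_|/negbT wi]; split; rewrite ?eqc.
rewrite ex; apply: eq_bigr => i _; case: ifP => // /eqP ->.
by rewrite !scale0r.
Qed.

Lemma conv_exists S n c x : conv S x -> c < dot n x -> exists2 y, S y & c < dot n y.
Proof.
move=> Kx lt_c; apply: contrapT => no.
have : - c <= dot (- n) x.
  apply: (conv_ge Kx) => y Sy; rewrite dotNl lerN2 leNgt.
  by apply/negP => h; apply: no; exists y.
by rewrite dotNl lerN2 leNgt lt_c.
Qed.

Lemma conv_nonempty S x : conv S x -> exists y, S y.
Proof.
move=> [[|m] [pt [w [Spt w0 w1 ex]]]]; last by exists (pt ord0).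
by move: w1; rewrite big_ord0 => /esym/eqP; rewrite oner_eq0.
Qed.

Lemma conv_segment a b x : conv (segment a b) x -> segment a b x.
Proof.
move=> [m [pt [w [Spt w0 w1 ->]]]].
have [t ht] := choice Spt.
exists (\sum_i w i * t i); split.
- by apply: sumr_ge0 => i _; rewrite mulr_ge0 //; case: (ht i).
- by rewrite -w1; apply: ler_sum => i _; rewrite ler_piMr //; case: (ht i).
rewrite scaler_suml -{1}[a]scale1r -w1 scaler_suml -big_split /=.
by apply: eq_bigr => i _; have [_ _ ->] := ht i; rewrite scalerDr scalerA.
Qed.

Lemma segment_conv S a b x : S a -> S b -> segment a b x -> conv S x.
Proof.
move=> Sa Sb [t [t0 t1 ->]].
exists 2%N, (fun i : 'I_2 => if i == 0 then a else b), (fun i : 'I_2 => if i == 0 then 1 - t else t).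
split.
- by move=> i; case: ifP.
- by move=> i; case: ifP; rewrite ?subr_ge0.
- by rewrite !big_ord_recl big_ord0 /= addr0 subrK.
- by rewrite !big_ord_recl big_ord0 /=; apply: vecP; rewrite !mxE; ring.
Qed.

Lemma segmentl a b : segment a b a.
Proof. by exists 0; split; rewrite ?ler01 // scale0r addr0. Qed.
Lemma segmentr a b : segment a b b.
Proof. by exists 1; split; rewrite ?ler01 // scale1r addrC subrK. Qed.
Lemma segmentC a b x : segment a b x -> segment b a x.
Proof.
move=> [t [t0 t1 ->]]; exists (1 - t); split; first by rewrite subr_ge0.
  by rewrite gerBl.
by apply: vecP; rewrite !mxE; ring.
Qed.

Lemma exposedP S n x : exposed (conv S) n x <->
  conv S x /\ forall y, S y -> dot n y <= dot n x.
Proof.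
split=> -[Kx h]; split=> // y; first by move=> /conv_sub/h.
move=> Ky; rewrite -lerN2 -!dotNl; apply: (conv_ge Ky) => z Sz.
by rewrite !dotNl lerN2 h.
Qed.

Lemma int_box_finite (M : R) : exists Q : seq vec,
  forall x, int_pt x -> (forall i, `|x i 0| <= M) -> x \in Q.
Proof.
pose m := (Num.truncn M).+1.
pose F (z : 'cV['I_(2 * m).+1]_3) : vec := map_mx (fun k : 'I__ => (k : nat)%:R - m%:R) z.
exists (map F (enum {: 'cV['I_(2 * m).+1]_3})) => x xint xM.
have H i : exists k : 'I_(2 * m).+1, x i 0 = (k : nat)%:R - m%:R.
  have /intrP [z ez] := xint i.
  have M0 : 0 <= M by exact: le_trans (xM i).
  have hz : `|z| <= m.
    rewrite -(ler_int R) intr_norm -ez (le_trans (xM i)) //.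
    by rewrite ltW // truncnS_gt.
  have lt_k : (absz (z + m%:Z)%R < (2 * m).+1)%N by lia.
  exists (Ordinal lt_k) => /=.
  rewrite ez !pmulrn -intrB; congr (_%:~R); lia.
have [k hk] := choice H.
apply/mapP; exists (\col_i k i); rewrite ?mem_enum //.
by apply/colP => i; rewrite !mxE hk.
Qed.

End Conv.

(** * Faces and edges of the hull *)

Section Flags.
Variable R : realType.
Notation vec := 'cV[R]_3.
Variable S : vec -> Prop.
Implicit Types (x y a b n k l N w : vec) (s : R).

Definition supp N := forall x, S x -> 1 <= dot N x.

(* N is the normal, scaled to be 1 on the face, of a face having a and b as the
   end points of one of its edges; for s = 1 (resp. -1) the face lies on the right
   (resp. left) of the edge oriented from a to b, seen from outside. *)
Definition flag s a b N :=
  [/\ [/\ S a, S b & a != b], [/\ supp N, dot N a = 1 & dot N b = 1],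
      forall x, S x -> dot N x = 1 -> 0 <= s * det3 a b x,
      (exists x, [/\ S x, dot N x = 1 & 0 < s * det3 a b x]) &
      forall x, S x -> dot N x = 1 -> det3 a b x = 0 -> segment a b x].

(** The geometry of faces and edges rests on these four properties. [Sopen] says that every point of
    S is interior to the cone spanned by S; [Sbd] is uniform in [N], so it controls all faces
    through [a] at once. *)
Hypothesis Sint : forall x, S x -> int_pt x.
Hypothesis Sdbl : forall x, S x -> S (2 *: x).
Hypothesis Sopen : forall n p, S p -> dot n p = 0 ->
  (forall x, S x -> 0 <= dot n x) -> n = 0.
Hypothesis Sbd : forall a, S a -> exists2 c, 0 < c &
  forall N, supp N -> dot N a = 1 -> forall x, S x -> forall i, `|x i 0| <= c * dot N x.

Local Notation K := (conv S).

Lemma det3_swap23 a b x : det3 a x b = - det3 a b x.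
Proof. by rewrite !vE; ring. Qed.
Lemma det3_swap12 a b x : det3 b a x = - det3 a b x.
Proof. by rewrite !vE; ring. Qed.
Lemma det3_same a b : (det3 a b a = 0) * (det3 a b b = 0) * (det3 a a b = 0).
Proof. by rewrite !vE; do !split; ring. Qed.

(** The maximum of [n] on the hull cannot be 0, since [Sopen] would give [n = 0], nor positive,
    since doubling a point of S would exceed it. *)
Lemma exposed_supp n x : n != 0 -> exposed K n x ->
  dot n x < 0 /\ supp ((dot n x)^-1 *: n).
Proof.
move=> n0 /exposedP[Kx h].
have lt0 : dot n x < 0.
  rewrite ltNge; apply/negP; rewrite le_eqVlt => /predU1P[/esym nx|nx].
    have [p [Sp np]] : exists p, S p /\ dot (- n) p = 0.
      have hN y : S y -> 0 <= dot (- n) y.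
        by move=> Sy; rewrite dotNl oppr_ge0 -nx h.
      have [|p] := conv_nonempty (conv_face Kx hN _); first by rewrite dotNl nx oppr0.
      by exists p.
    move/eqP: n0; apply; rewrite -[n]opprK (Sopen Sp np) ?oppr0 //.
    by move=> y Sy; rewrite dotNl oppr_ge0 -nx h.
  have [p Sp np] := conv_exists (n := n) (c := dot n x / 2) Kx ltac:(lra).
  by have := h _ (Sdbl Sp); rewrite dotZr; lra.
split=> // y Sy; rewrite dotZl mulrC -[X in X <= _](@mulfV _ (dot n x)) ?lt_eqF //.
by rewrite ler_nM2r ?invr_lt0 // h.
Qed.

Lemma supp_exposed N x : supp N -> K x -> dot N x = 1 -> exposed K (- N) x.
Proof.
move=> sN Kx Nx; apply/exposedP; split=> // y Sy.
by rewrite !dotNl lerN2 Nx sN.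
Qed.

Lemma supp_finite a M : S a -> exists Q : seq vec,
  forall N, supp N -> dot N a = 1 -> forall x, S x -> dot N x <= M -> x \in Q.
Proof.
move=> Sa; have [c c0 hc] := Sbd Sa.
have [Q hQ] := int_box_finite (c * M).
exists Q => N sN Na x Sx NM; apply: hQ; first exact: Sint.
by move=> i; apply: le_trans (hc N sN Na x Sx i) _; rewrite ler_pM2l.
Qed.

Lemma flag_neq0 s a b N : flag s a b N -> s != 0.
Proof.
move=> [_ _ _ [x [_ _ h]] _]; apply: contraTneq h => ->.
by rewrite mul0r ltxx.
Qed.

Lemma flag_cross_neq0 s a b N : flag s a b N -> cross a b != 0.
Proof.
move=> [_ _ _ [x [_ _ h]] _]; apply: contraTneq h; rewrite det3E => ->.
by rewrite (_ : dot 0 x = 0) ?mulr0 ?ltxx // !vE; ring.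
Qed.

Lemma flag_sym s a b N : flag s a b N -> flag (- s) b a N.
Proof.
move=> [[Sa Sb ab] [sN Na Nb] h1 [x [Sx Nx h2]] h3]; split.
- by rewrite eq_sym.
- by [].
- by move=> y Sy Ny; rewrite det3_swap12 mulrNN h1.
- by exists x; rewrite det3_swap12 mulrNN.
- by move=> y Sy Ny; rewrite det3_swap12 => /eqP; rewrite oppr_eq0 => /eqP D; apply/segmentC/h3.
Qed.

(** [N'] is at least 1 at the points where [N] is 1, which fixes the sign of the difference.
    Exchanging the two normals gives the opposite sign, so they agree. *)
Lemma flag_uniqN_aux s a b N N' : flag s a b N -> flag s a b N' ->
  exists2 r, 0 <= s * r & N' - N = r *: cross a b.
Proof.
move=> [_ [sN Na Nb] _ [k [Sk Nk hk]] _] [_ [sN' Na' Nb'] _ _ _].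
have D : det3 a b k != 0 by apply: contraTneq hk => ->; rewrite mulr0 ltxx.
exists ((dot N' k - dot N k) / det3 a b k); last by apply: dot_basis; rewrite ?Na ?Nb.
have s0 : s != 0 by apply: contraTneq hk => ->; rewrite mul0r ltxx.
have -> : s * ((dot N' k - dot N k) / det3 a b k) = s ^+ 2 * (dot N' k - 1) / (s * det3 a b k).
  by rewrite Nk; field; rewrite s0 D.
by rewrite divr_ge0 ?(ltW hk) // mulr_ge0 ?sqr_ge0 // subr_ge0 sN'.
Qed.

Lemma flag_uniqN s a b N N' : flag s a b N -> flag s a b N' -> N = N'.
Proof.
move=> f f'; have [r r0 e] := flag_uniqN_aux f f'; have [r' r0' e'] := flag_uniqN_aux f' f.
have : (r + r') *: cross a b = 0 by rewrite scalerDl -e -e' addrC subrKA subrr.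
move/eqP; rewrite scaler_eq0 (negPf (flag_cross_neq0 f)) orbF => /eqP rr.
have sr : s * r = 0.
  apply/eqP; rewrite eq_le r0 andbT.
  by move: r0'; rewrite (_ : r' = - r) ?mulrN ?oppr_ge0 //; apply/eqP; rewrite -addr_eq0 addrC rr.
move: e; move/eqP: sr; rewrite mulf_eq0 (negPf (flag_neq0 f)) => /eqP ->.
by rewrite scale0r => /eqP; rewrite subr_eq0 => /eqP.
Qed.

Lemma segment_antisym a b b' : a != b -> segment a b b' -> segment a b' b -> b = b'.
Proof.
move=> ab [t [t0 t1 e]] [t' [t'0 t'1 e']].
have : (1 - t' * t) *: (b - a) = 0.
  have eb : b' - a = t *: (b - a) by rewrite e addrC addKr.
  have eb' : b - a = t' *: (b' - a) by rewrite {1}e' addrC addKr.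
  by rewrite scalerBl scale1r -scalerA -eb -eb' subrr.
move/eqP; rewrite scaler_eq0 [b - a == 0]subr_eq0 [b == a]eq_sym (negPf ab) orbF => /eqP tt.
have -> : b' = b; last by [].
by rewrite e (_ : t = 1) ?scale1r 1?addrC ?subrK //; nra.
Qed.

(** Seen from [a], both edges bound the face on the same side, so their rays coincide, and each end
    point lies on the segment to the other. *)
Lemma flag_uniqb s a b b' N : flag s a b N -> flag s a b' N -> b = b'.
Proof.
move=> f; have s0 := flag_neq0 f.
case: f => [[Sa Sb ab] [sN Na Nb] h1 _ h3] [[_ Sb' ab'] [_ _ Nb'] h1' _ h3'].
have D : det3 a b b' = 0.
  apply/eqP; rewrite -(mulrI_eq0 _ (lregP s0)) eq_le h1 // andbT.
  by rewrite -oppr_ge0 -mulrN -det3_swap23 h1'.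
apply: (segment_antisym ab); first exact: h3.
by apply: h3' => //; rewrite det3_swap23 D oppr0.
Qed.

(* b' is the point of the face making the largest angle with the edge ab at a. *)
Lemma flag_turn s a b N : flag s a b N ->
  exists2 b', flag (- s) a b' N & det3 a b b' != 0.
Proof.
move=> f; have s0 := flag_neq0 f.
case: f => [[Sa Sb ab] [sN Na Nb] h1 [k [Sk Nk hk]] h3].
have [Q hQ] := supp_finite 1 Sa.
(* Up to a common factor, [G x] and [H x] are the coordinates of [x - a] along [b - a] and [k - a];
   a small quotient [G x / H x] means a large angle with the edge. *)
pose H x := s * det3 a b x; pose G x := s * det3 a x k.
pose P x := [/\ S x, dot N x = 1 & 0 < H x].
have PQ x : S x -> dot N x = 1 -> x \in Q.
  by move=> Sx Nx; apply: (hQ N) => //; rewrite Nx.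
have [|m [mQ Pm minm]] := @seq_argmin R _ P (fun x => G x / H x) Q.
  by exists k; rewrite ?PQ.
pose P2 x := P x /\ G x / H x = G m / H m.
(* Among the points of the extreme ray the farthest from [a] is taken, so that the segment from [a]
   to [b'] covers the others. *)
have [|b' [b'Q [[Sb' Nb' H0] eb'] maxb']] := @seq_argmin R _ P2 (fun x => - H x) Q.
  by exists m.
(* This identity converts the comparison of quotients into the side of the line [a b'] on which [x]
   lies. *)
have plucker x : det3 a b' x * H k * s = G b' * H x - H b' * G x.
  by rewrite /H /G !vE; ring.
have det_le x : S x -> dot N x = 1 -> 0 <= - s * det3 a b' x.
  move=> Sx Nx; have : G b' * H x - H b' * G x <= 0.
    have := h1 x Sx Nx; rewrite le_eqVlt => /predU1P[e|H1].
      have [t [t0 t1 ex]] : segment a b x.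
        by apply: h3 => //; apply/eqP; rewrite -(mulrI_eq0 _ (lregP s0)) -e.
      rewrite /H -e mulr0 sub0r oppr_le0 mulr_ge0 ?(ltW H0) // /G ex.
      have -> : s * det3 a (a + t *: (b - a)) k = t * (s * det3 a b k) by rewrite !vE; ring.
      by rewrite mulr_ge0 ?(ltW hk).
    rewrite subr_le0 [leRHS]mulrC -ler_pdivrMr // mulrAC -ler_pdivlMr //.
    rewrite eb'; apply: minm; [exact: PQ|split=> //].
  by rewrite -plucker; have : 0 < H k := hk; nra.
exists b'; last by apply: contraTneq H0 => e; rewrite /H e mulr0 ltxx.
split=> //.
- split=> //; apply: contraTneq H0 => <-.
  by rewrite /H det3_same mulr0 ltxx.
- exists b; split=> //; rewrite det3_swap23 mulrNN //.
- move=> x Sx Nx D.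
  have ab' : a != b' by apply: contraTneq H0 => <-; rewrite /H det3_same mulr0 ltxx.
  have [t ex] := plane_line ab' Na Nb' Nx D.
  have Ht : H x = t * H b' by rewrite /H ex !vE; ring.
  have := h1 x Sx Nx; rewrite -/(H x) Ht pmulr_lge0 // => t0.
  exists t; split=> //.
  move: t0; rewrite le_eqVlt => /predU1P[<-|t0]; first exact: ler01.
  have Hx : 0 < H x by rewrite Ht mulr_gt0.
  have := maxb' x (PQ _ Sx Nx); rewrite lerN2 Ht ger_pMl //; apply.
  split=> //; rewrite -eb'; apply/eqP; rewrite eqr_div ?lt0r_neq0 //.
  by apply/eqP; have := plucker x; rewrite D !mul0r; lra.
Qed.

Lemma supp_functional_bound a (w : vec) : S a -> exists2 c, 0 < c &
  forall N, supp N -> dot N a = 1 -> forall x, S x -> `|dot w x| <= c * dot N x.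
Proof.
move=> Sa; have [c c0 hc] := Sbd Sa.
have W : 0 <= `|w 0 0| + `|w 1 0| + `|w i2 0| by rewrite !addr_ge0.
exists ((`|w 0 0| + `|w 1 0| + `|w i2 0| + 1) * c); first by rewrite mulr_gt0 // ltr_wpDl.
move=> N sN Na x Sx; have h i := hc N sN Na x Sx i.
have cN : 0 <= c * dot N x by apply: le_trans (h 0).
rewrite dotE -mulrA.
have t (p q r : R) : `|r| <= c * dot N x -> `|p| <= q -> `|p * r| <= q * (c * dot N x).
  by move=> hy hu; rewrite normrM ler_pM.
have := t _ _ _ (h 0) (lexx `|w 0 0|); have := t _ _ _ (h 1) (lexx `|w 1 0|).
have := t _ _ _ (h i2) (lexx `|w i2 0|).
have := ler_normD (w 0 0 * x 0 0 + w 1 0 * x 1 0) (w i2 0 * x i2 0).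
have := ler_normD (w 0 0 * x 0 0) (w 1 0 * x 1 0).
by lra.
Qed.

(* Tilt N about the line ab, away from the face, until it meets a new point of S. *)
Lemma flag_rotate s a b N : flag s a b N -> exists N', flag (- s) a b N'.
Proof.
move=> f; have s0 := flag_neq0 f; have w0 := flag_cross_neq0 f.
case: f => [[Sa Sb ab] [sN Na Nb] h1 [k [Sk Nk hk]] h3].
pose w := s *: cross a b.
have wE x : dot w x = s * det3 a b x by rewrite /w dotZl -det3E.
have wa : dot w a = 0 by rewrite wE det3_same mulr0.
have wb : dot w b = 0 by rewrite wE det3_same mulr0.
pose P x := S x /\ dot w x < 0.
(* [r x] is the value of T at which [N + T *: w] drops to 1 at [x]. *)
pose r x := (dot N x - 1) / - dot w x.
have r_ge0 x : P x -> 0 <= r x.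
  by move=> [Sx wx]; rewrite divr_ge0 ?subr_ge0 ?sN // oppr_ge0 ltW.
pose E : set R := fun v : R => exists2 x, P x & v = r x.
have lbE : has_lbound E by exists 0 => _ [x Px ->]; exact: r_ge0.
have [x1 Px1] : exists x, P x.
  apply: contrapT => no; suff /eqP : w = 0 by rewrite scaler_eq0 (negPf s0) (negPf w0).
  apply: (Sopen Sa wa) => x Sx; rewrite leNgt; apply/negP => wx.
  by apply: no; exists x.
have infE : has_inf E by split=> //; exists (r x1), x1.
pose T := inf E.
have T_le x : P x -> T <= r x by move=> Px; apply: ge_inf => //; exists x.
have T0 : 0 <= T by apply: lb_le_inf; [exists (r x1), x1|move=> _ [x Px ->]; exact: r_ge0].
pose N' := N + T *: w.
have N'E x : dot N' x = dot N x + T * dot w x by rewrite /N' !dotL.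
have sN' : supp N'.
  move=> x Sx; rewrite N'E; have := sN x Sx.
  have [wx|wx] := leP 0 (dot w x); first by have := mulr_ge0 T0 wx; lra.
  have := T_le x (conj Sx wx); rewrite ler_pdivlMr ?oppr_gt0 //; lra.
have N'a : dot N' a = 1 by rewrite N'E wa mulr0 addr0.
have N'b : dot N' b = 1 by rewrite N'E wb mulr0 addr0.
have [c c0 hc] := supp_functional_bound w Sa.
have [Q hQ] := supp_finite 2 Sa.
(* With [e * c = 1/2], a point with [r x < T + e] satisfies [dot N' x - 1 < dot N' x / 2], so
   [dot N' x < 2]. *)
pose e := (2 * c)^-1; have e0 : 0 < e by rewrite invr_gt0 mulr_gt0.
(* near-minimisers of r lie in a finite set, so the infimum is attained *)
have near x : P x -> r x < T + e -> x \in Q.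
  move=> [Sx wx]; rewrite ltr_pdivrMr ?oppr_gt0 // => h.
  apply: (hQ N') => //; rewrite N'E.
  have := hc N' sN' N'a x Sx; rewrite ltr0_norm // N'E => h'.
  have : e * (- dot w x) <= e * (c * (dot N x + T * dot w x)) by rewrite ler_pM2l.
  rewrite [X in _ <= X]mulrA (_ : e * c = 2^-1); last by rewrite /e; field; rewrite gt_eqF.
  by nra.
have [_ [x2 Px2 ->] lt_x2] := inf_adherent e0 infE.
have [|x0 [x0Q [Sx0 wx0] minx0]] := @seq_argmin R _ P r Q; first by exists x2; rewrite ?near.
have eT : T = r x0.
  apply/eqP; rewrite eq_le T_le //=; apply: lb_le_inf; first by exists (r x1), x1.
  move=> _ [x Px ->]; have [lt_x|ge_x] := ltP (r x) (T + e); first by rewrite minx0 // near.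
  by apply: le_trans ge_x; apply: le_trans (ltW lt_x2); rewrite minx0 // near.
have N'x0 : dot N' x0 = 1.
  rewrite N'E eT /r; field; exact: ltr0_neq0.
(* For T = 0 the point [x0] would lie in the old face, on the wrong side of [a b]. *)
have Tpos : 0 < T.
  rewrite lt_def T0 andbT; apply/eqP => T00; move: N'x0; rewrite N'E T00 mul0r addr0 => Nx0.
  by have := h1 x0 Sx0 Nx0; rewrite -wE leNgt wx0.
have wle x : S x -> dot N' x = 1 -> dot w x <= 0.
  move=> Sx; rewrite N'E leNgt => h; apply/negP => wx.
  by have := sN x Sx; have := mulr_gt0 Tpos wx; lra.
exists N'; split=> //.
- by move=> x Sx Nx; rewrite mulNr -wE oppr_ge0 wle.
- by exists x0; rewrite mulNr -wE oppr_gt0.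
- move=> x Sx Nx D; apply: h3 => //.
  by move: Nx; rewrite N'E wE D !mulr0 addr0.
Qed.

(** * Edges as pairs of opposite flags *)

Lemma flag_segment s a b N1 N2 x : flag s a b N1 -> flag (- s) a b N2 -> K x ->
  dot N1 x = 1 -> dot N2 x = 1 -> segment a b x.
Proof.
move=> f1 f2 Kx N1x N2x; have s0 := flag_neq0 f1.
case: f1 f2 => [_ [sN1 _ _] h1 _ h3] [_ [sN2 _ _] h1' _ _].
(* Applied to both normals in turn, [conv_face] writes [x] as a mean of points of S that lie in both
   faces. *)
have /conv_face := conv_face Kx (fun y Sy => sN1 y Sy) N1x.
move=> /(_ N2 1 (fun y Sy => sN2 y Sy.1) N2x) => Fx.
apply/conv_segment/(conv_mono _ Fx) => y [[Sy N1y] N2y].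
apply: h3 => //; apply/eqP; rewrite -(mulrI_eq0 _ (lregP s0)) eq_le h1 // andbT.
by rewrite -oppr_ge0 -mulNr h1'.
Qed.

(** Passes from exposed real points of the hull to points of S. Dividing by the negative value on
    the face reverses the outward normals, so the right side becomes [0 < det3 a b k]. *)
Lemma edge_flags a b k l : edge_datum K a b k l -> exists N1 N2,
  [/\ flag 1 a b N1, flag (-1) a b N2,
      [/\ K k, dot N1 k = 1 & 0 < det3 a b k] &
      [/\ K l, dot N2 l = 1 & det3 a b l < 0]].
Proof.
move=> [ab [n1 [n2 [[n10 _] [n20 _] hseg [xk nk Dk] [xl nl Dl]]]]].
have [xa1 xa2] := (hseg a).2 (segmentl a b).
have [xb1 xb2] := (hseg b).2 (segmentr a b).
have [m1 sN1] := exposed_supp n10 xa1; have [m2 sN2] := exposed_supp n20 xa2.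
set N1 := _ *: n1 in sN1; set N2 := _ *: n2 in sN2.
have sup_eq n x y : exposed K n x -> exposed K n y -> dot n x = dot n y.
  by move=> [Kx hx] [Ky hy]; apply/eqP; rewrite eq_le hx // hy.
have N1E x : exposed K n1 x -> dot N1 x = 1.
  by move=> h; rewrite dotZl (sup_eq _ _ _ h xa1) mulVf ?lt_eqF.
have N2E x : exposed K n2 x -> dot N2 x = 1.
  by move=> h; rewrite dotZl (sup_eq _ _ _ h xa2) mulVf ?lt_eqF.
have exp1 x : K x -> dot N1 x = 1 -> exposed K n1 x.
  move=> Kx; rewrite dotZl => /(canRL (mulVKf _)); rewrite lt_eqF // mulr1 => h.
  by split=> // y Ky; rewrite h //; apply xa1.2.
have exp2 x : K x -> dot N2 x = 1 -> exposed K n2 x.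
  move=> Kx; rewrite dotZl => /(canRL (mulVKf _)); rewrite lt_eqF // mulr1 => h.
  by split=> // y Ky; rewrite h //; apply xa2.2.
have n1E : n1 = dot n1 a *: N1 by rewrite /N1 scalerA divff ?scale1r ?lt_eqF.
have N_neq0 N : dot N a = 1 -> N != 0.
  by move=> Na; apply/eqP => N0; move: Na; rewrite N0 dotE !mxE !mul0r !addr0 => /esym/eqP; rewrite oner_eq0.
have n2E : n2 = dot n2 a *: N2 by rewrite /N2 scalerA divff ?scale1r ?lt_eqF.
have N1a := N1E a xa1; have N1b := N1E b xb1; have N1k := N1E k xk.
have N2a := N2E a xa2; have N2b := N2E b xb2; have N2l := N2E l xl.
have D1 : 0 < det3 a b k.
  rewrite lt_def; apply/andP; split.
    by apply/eqP => D; case: nk; exact: (plane_line ab N1a N1b N1k D).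
  move: Dk; rewrite det3E -(det3_normal N1a N1b N1k) {1}n1E dotZl dotZr mulrCA.
  by rewrite nmulr_rlt0 // => /ltW; rewrite pmulr_lge0 // dot_self_gt0 // N_neq0.
have D2 : det3 a b l < 0.
  rewrite lt_def eq_sym; apply/andP; split.
    by apply/eqP => D; case: nl; exact: (plane_line ab N2a N2b N2l D).
  move: Dl; rewrite det3E -(det3_normal N2a N2b N2l) {1}n2E dotZl dotZr mulrCA.
  by rewrite nmulr_rgt0 // => /ltW; rewrite pmulr_lle0 // dot_self_gt0 // N_neq0.
have Kk := xk.1; have Kl := xl.1.
(* An end point of the common segment is extreme in it, hence lies in S. *)
have end_S a' b' : a' != b' -> (forall x, segment a b x <-> segment a' b' x) -> S a'.
  move=> ab' hs; have [xa' xa''] := (hseg a').2 ((hs a').2 (segmentl a' b')).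
  have Ka' := xa'.1.
  have /conv_face := conv_face Ka' (fun y Sy => sN1 y Sy) (N1E _ xa').
  move=> /(_ N2 1 (fun y Sy => sN2 y Sy.1) (N2E _ xa'')) => Fx.
  have segF y : (S y /\ dot N1 y = 1) /\ dot N2 y = 1 -> segment a' b' y.
    move=> [[Sy N1y] N2y]; apply/hs/hseg.
    by split; [apply: exp1|apply: exp2] => //; exact: conv_sub.
  have := conv_face (n := b' - a') (c := dot (b' - a') a') Fx.
  case/(_ _ erefl)/conv_nonempty => [y /segF [t [t0 t1 ->]]|y [/[dup] hy /segF [t [t0 t1 ey]]]].
    by rewrite dotDr dotZr lerDl mulr_ge0 ?dot_self_ge0.
  rewrite {1}ey dotDr dotZr => /eqP; rewrite -subr_eq0 addrAC subrr add0r mulf_eq0.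
  have ba0 : b' - a' != 0 by rewrite subr_eq0 eq_sym.
  rewrite (gt_eqF (dot_self_gt0 ba0)) orbF => /eqP t00.
  by case: hy => [[Sy _] _]; move: Sy; rewrite ey t00 scale0r addr0.
have Sa : S a by apply: (end_S a b).
have Sb : S b by apply: (end_S b a); rewrite 1?eq_sym // => x; split; exact: segmentC.
have E : N1 - N2 = omega a b k l *: cross a b.
  exact: omega_normals (lt0r_neq0 D1) (ltr0_neq0 D2).
have Ex x : dot N1 x - dot N2 x = omega a b k l * det3 a b x.
  by rewrite -dotBl E dotZl det3E.
have N2k : 1 <= dot N2 k by apply: conv_ge Kk _.
have N1l : 1 <= dot N1 l by apply: conv_ge Kl _.
(* The value 0 would put [k] into the second face as well, hence onto the line [a b]. *)
have om0 : omega a b k l < 0.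
  rewrite lt_neqAle; apply/andP; split.
    apply/eqP => om0; have := Ex k; rewrite om0 mul0r N1k => /eqP; rewrite subr_eq0 => /eqP N2k1.
    have := (hseg k).1 (conj xk (exp2 _ Kk (esym N2k1))).
    by move=> [t [_ _ ek]]; case: nk; exists t.
  by rewrite -(pmulr_lle0 _ D1) -Ex N1k subr_le0.
have hsegS x : S x -> dot N1 x = 1 -> dot N2 x = 1 -> segment a b x.
  by move=> Sx h1 h2; apply/hseg; split; [apply: exp1|apply: exp2] => //; exact: conv_sub.
exists N1, N2; split=> //; split=> //.
- move=> x Sx N1x; have := Ex x; have := sN2 x Sx; rewrite N1x mul1r.
  by move=> h e; rewrite -(nmulr_rle0 _ om0) -e subr_le0.
- have [y [Sy N1y] hy] : exists2 y, S y /\ dot N1 y = 1 & 0 < dot (cross a b) y.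
    apply: (conv_exists (conv_face Kk (fun y Sy => sN1 y Sy) N1k)).
    by rewrite -det3E.
  by exists y; rewrite mul1r det3E.
- move=> x Sx N1x D; apply: hsegS => //.
  by have := Ex x; rewrite D mulr0 N1x => /eqP; rewrite subr_eq0 => /eqP.
- move=> x Sx N2x; have := Ex x; have := sN1 x Sx; rewrite N2x mulN1r oppr_ge0.
  by move=> h e; rewrite -(nmulr_rge0 _ om0) -e subr_ge0.
- have [y [Sy N2y] hy] : exists2 y, S y /\ dot N2 y = 1 & 0 < dot (- cross a b) y.
    apply: (conv_exists (conv_face Kl (fun y Sy => sN2 y Sy) N2l)).
    by rewrite dotNl oppr_gt0 -det3E.
  by exists y; rewrite mulN1r det3E -dotNl.
- move=> x Sx N2x D; apply: hsegS => //.
  by have := Ex x; rewrite D mulr0 N2x => /eqP; rewrite subr_eq0 => /eqP.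
Qed.

(** Any points of the two faces on the proper sides complete an edge datum, so [k] and [l] can be
    exchanged for others and edges can be transported by linear maps. *)
Lemma flags_edge a b k l N1 N2 : flag 1 a b N1 -> flag (-1) a b N2 ->
  K k -> dot N1 k = 1 -> 0 < det3 a b k ->
  K l -> dot N2 l = 1 -> det3 a b l < 0 -> edge_datum K a b k l.
Proof.
move=> f1 f2 Kk N1k Dk Kl N2l Dl.
have [[Sa Sb ab] [sN1 N1a N1b] _ _ _] := f1; have [_ [sN2 N2a N2b] _ _ _] := f2.
have Ka := conv_sub Sa; have Kb := conv_sub Sb.
have N0 N : dot N a = 1 -> N != 0.
  by move=> Na; apply/eqP => N0; move: Na; rewrite N0 dotE !mxE !mul0r !addr0 => /esym/eqP; rewrite oner_eq0.
have off x : det3 a b x != 0 -> ~ on_line a b x.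
  by move=> D [t e]; move/eqP: D; apply; rewrite e !vE; ring.
have ind x : det3 a b x != 0 -> lin_indep2 (b - a) (x - a).
  move=> D p q e.
  have q0 : q = 0.
    have : det3 a b (p *: (b - a) + q *: (x - a)) = q * det3 a b x by rewrite !vE; ring.
    rewrite e => /esym; rewrite (_ : det3 a b 0 = 0); last by rewrite !vE; ring.
    by move/eqP; rewrite mulf_eq0 (negPf D) orbF => /eqP.
  move: e; rewrite q0 scale0r addr0 => /eqP; rewrite scaler_eq0 [b - a == 0]subr_eq0.
  by rewrite [b == a]eq_sym (negPf ab) orbF => /eqP.
split=> //; exists (- N1), (- N2); split.
- split; first by rewrite oppr_eq0 N0.
  exists a, b, k; split; try exact: supp_exposed; exact: ind (lt0r_neq0 Dk).
- split; first by rewrite oppr_eq0 N0.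
  exists a, b, l; split; try exact: supp_exposed; exact: ind (ltr0_neq0 Dl).
- move=> x; split=> [[[Kx h1] [_ h2]]|hx].
    have eqN N : supp N -> dot N a = 1 -> (forall y, K y -> dot (- N) y <= dot (- N) x) -> dot N x = 1.
      move=> sN Na h; have := h a Ka; rewrite !dotNl lerN2 Na => le1.
      by apply/eqP; rewrite eq_le le1 /=; apply: conv_ge Kx _.
    by apply: (flag_segment f1 f2) => //; apply: eqN.
  have Kx := segment_conv Sa Sb hx; have [t [t0 t1 ex]] := hx.
  by split; apply: supp_exposed => //; rewrite ex dotDr dotZr dotBr ?N1a ?N1b ?N2a ?N2b; ring.
- split; [exact: supp_exposed|exact: off (lt0r_neq0 Dk)|].
  by rewrite det3E -(det3_normal N1a N1b N1k) dotZl dotNr mulrN oppr_lt0 mulr_gt0 // dot_self_gt0 // N0.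
- split; [exact: supp_exposed|exact: off (ltr0_neq0 Dl)|].
  by rewrite det3E -(det3_normal N2a N2b N2l) dotZl dotNr mulrN oppr_gt0 nmulr_rlt0 // dot_self_gt0 // N0.
Qed.

(** One face suffices, since [flag_rotate] supplies the second. *)
Lemma flag_is_edge s a b N : s = 1 \/ s = -1 -> flag s a b N -> is_edge K a b.
Proof.
have main N1 N2 : flag 1 a b N1 -> flag (-1) a b N2 -> is_edge K a b.
  move=> f1 f2; have [_ _ _ [k [Sk N1k Dk]] _] := f1; have [_ _ _ [l [Sl N2l Dl]] _] := f2.
  exists k, l; apply: (flags_edge f1 f2) => //; try exact: conv_sub.
    by rewrite mul1r in Dk.
  by rewrite mulN1r oppr_gt0 in Dl.
move=> [->|->] f; have [N' f'] := flag_rotate f; first exact: main f f'.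
by move: f'; rewrite opprK => f'; exact: main f' f.
Qed.

Lemma edge_omega a b k l : edge_datum K a b k l -> exists N1 N2,
  [/\ flag 1 a b N1, flag (-1) a b N2, N1 - N2 = omega a b k l *: cross a b &
      omega a b k l < 0].
Proof.
move=> /edge_flags [N1 [N2 [f1 f2 [Kk N1k Dk] [Kl N2l Dl]]]]; exists N1, N2.
have [_ [sN1 N1a N1b] h1 [x [Sx N1x hx]] _] := f1; have [_ [sN2 N2a N2b] h2 _ _] := f2.
have E := omega_normals N1a N1b N1k N2a N2b N2l (lt0r_neq0 Dk) (ltr0_neq0 Dl).
split=> //.
have : dot (N1 - N2) x = omega a b k l * det3 a b x by rewrite E dotZl det3E.
rewrite mul1r in hx; have N2x := sN2 x Sx.
rewrite dotBl N1x => e; rewrite ltNge; apply/negP => om0.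
have N2x1 : dot N2 x = 1 by have := mulr_ge0 om0 (ltW hx); lra.
by have := h2 x Sx N2x1; lra.
Qed.

Lemma edge_omega_uniq a b k l k' l' : edge_datum K a b k l -> edge_datum K a b k' l' ->
  omega a b k l = omega a b k' l'.
Proof.
move=> /edge_omega [N1 [N2 [f1 f2 e _]]] /edge_omega [N1' [N2' [f1' f2' e' _]]].
have : (omega a b k l - omega a b k' l') *: cross a b = 0.
  by rewrite scalerBl -e -e' (flag_uniqN f1 f1') (flag_uniqN f2 f2') subrr.
move/eqP; rewrite scaler_eq0 (negPf (flag_cross_neq0 f1)) orbF subr_eq0.
by move/eqP.
Qed.

Lemma edge_S a b k l : edge_datum K a b k l -> [/\ S a, S b & a != b].
Proof. by move=> /edge_flags [N1 [N2 [[h _ _ _ _] _ _ _]]]. Qed.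

(** In an edge datum [k] and [l] may be arbitrary real points of the faces; rationality of the
    coefficient needs them in S. *)
Lemma edge_int a b k l : edge_datum K a b k l ->
  exists k' l', [/\ S k', S l' & edge_datum K a b k' l'].
Proof.
move=> /edge_flags [N1 [N2 [f1 f2 _ _]]].
have [_ _ _ [k' [Sk N1k Dk]] _] := f1; have [_ _ _ [l' [Sl N2l Dl]] _] := f2.
exists k', l'; split=> //; apply: (flags_edge f1 f2) => //; try exact: conv_sub.
  by rewrite mul1r in Dk.
by rewrite mulN1r oppr_gt0 in Dl.
Qed.

Lemma edge_sym a b k l : edge_datum K a b k l -> edge_datum K b a l k.
Proof.
move=> /edge_flags [N1 [N2 [f1 f2 [Kk N1k Dk] [Kl N2l Dl]]]].
have f1' := flag_sym f1; have := flag_sym f2; rewrite opprK => f2'.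
apply: (flags_edge f2' f1') => //; rewrite det3_swap12 ?oppr_gt0 ?oppr_lt0 //.
Qed.

(* Every face at a is the right face of exactly one edge leaving a and the left
   face of exactly one, so the differences N1 - N2 telescope around a. *)
Lemma edge_balance a (ns : seq vec) (om : vec -> R) :
  uniq ns -> (forall b, b \in ns <-> is_edge K a b) ->
  (forall b k l, edge_datum K a b k l -> om b = omega a b k l) ->
  \sum_(b <- ns) om b *: cross a b = 0.
Proof.
move=> uns nsE omE.
have /choice [N hN] : forall b, exists N : vec * vec, b \in ns ->
    [/\ flag 1 a b N.1, flag (-1) a b N.2 & om b *: cross a b = N.1 - N.2].
  move=> b; have [/nsE [k [l E]]|] := boolP (b \in ns); last by exists (0, 0).
  have [N1 [N2 [f1 f2 e _]]] := edge_omega E.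
  by exists (N1, N2) => _; split; rewrite //= e (omE _ _ _ E).
rewrite big_seq (eq_bigr (fun b => (N b).1 - (N b).2)); last by move=> b /hN [].
rewrite -big_seq sumrB; apply/eqP; rewrite subr_eq0; apply/eqP.
rewrite -(big_map (fun b => (N b).1) predT id) -(big_map (fun b => (N b).2) predT id).
apply: perm_big; apply: uniq_perm.
- rewrite map_inj_in_uniq // => b b' /hN [f _ _] /hN [f' _ _] e.
  by rewrite e in f; exact: flag_uniqb f f'.
- rewrite map_inj_in_uniq // => b b' /hN [_ f _] /hN [_ f' _] e.
  by rewrite e in f; exact: flag_uniqb f f'.
move=> F; apply/mapP/mapP => -[b bns ->].
  have [f _ _] := hN b bns; have [b' f' _] := flag_turn f.
  have b'ns : b' \in ns by apply/nsE; apply: flag_is_edge f'; right.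
  by exists b' => //; have [_ f'' _] := hN b' b'ns; exact: flag_uniqN f' f''.
have [_ f _] := hN b bns; have [b' + _] := flag_turn f; rewrite opprK => f'.
have b'ns : b' \in ns by apply/nsE; apply: flag_is_edge f'; left.
by exists b' => //; have [f'' _ _] := hN b' b'ns; exact: flag_uniqN f' f''.
Qed.

(** Turning and rotating yield a third face at [a]. The first face meets the other two along
    different lines through [a], so the sum of the three normals is minimal at [a] alone. *)
Lemma edge_vertex a b k l : edge_datum K a b k l -> is_vertex K a.
Proof.
move=> /edge_flags [N1 [N2 [f1 f2 _ _]]].
have [b' f1' D] := flag_turn f1; have [N3 f3] := flag_rotate f1'.
have [[Sa _ _] [sN1 N1a _] _ _ _] := f1; have [_ [sN2 N2a _] _ _ _] := f2.
have [_ [sN3 N3a _] _ _ _] := f3.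
split; first exact: conv_sub.
exists (- (N1 + N2 + N3)) => y Ky ya.
have h1 : 1 <= dot N1 y by apply: conv_ge Ky _.
have h2 : 1 <= dot N2 y by apply: conv_ge Ky _.
have h3 : 1 <= dot N3 y by apply: conv_ge Ky _.
rewrite !dotNl ltrN2 !dotDl N1a N2a N3a ltNge; apply/negP => le3.
have N1y : dot N1 y = 1 by lra.
have N2y : dot N2 y = 1 by lra.
have N3y : dot N3 y = 1 by lra.
have [t [_ _ ey]] := flag_segment f1 f2 Ky N1y N2y.
have [t' [_ _ ey']] := flag_segment f1' f3 Ky N1y N3y.
have t0 : t = 0.
  have : det3 a b' y = - t * det3 a b b' by rewrite ey !vE; ring.
  have -> : det3 a b' y = 0 by rewrite ey' !vE; ring.
  by move/esym/eqP; rewrite mulf_eq0 (negPf D) orbF oppr_eq0 => /eqP.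
by move/eqP: ya; apply; rewrite ey t0 scale0r addr0.
Qed.

(** Each neighbour has value 1 under some supporting normal at [a]; [supp_finite] covers all these
    normals with one list. *)
Lemma edge_neighbours a : exists2 ns : seq vec, uniq ns & forall b, b \in ns <-> is_edge K a b.
Proof.
have [Sa|nSa] := pselect (S a); last first.
  by exists [::] => // b; split=> // -[k [l /edge_S[Sa _ _]]].
have [Q hQ] := supp_finite 1 Sa.
exists (undup [seq b <- Q | `[< is_edge K a b >]]); first exact: undup_uniq.
move=> b; rewrite mem_undup mem_filter; split; first by move=> /andP[/asboolP].
move=> ab; apply/andP; split; first exact/asboolP.
have [k [l /edge_flags [N1 [N2 [[[_ Sb _] [sN Na Nb] _ _ _] _ _ _]]]]] := ab.
by apply: (hQ N1) => //; rewrite Nb.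
Qed.

Lemma vertex_S p : is_vertex K p -> S p.
Proof.
move=> [Kp [n hn]].
have h y : S y -> - dot n p <= dot (- n) y.
  move=> Sy; rewrite dotNl lerN2; have [->//|yp] := eqVneq y p.
  by rewrite ltW // hn //; exact: conv_sub.
have [|y [Sy]] := conv_nonempty (conv_face Kp h _); first by rewrite dotNl.
rewrite dotNl => /oppr_inj e; have [<-//|yp] := eqVneq y p.
by have := hn y (conv_sub Sy) yp; rewrite e ltxx.
Qed.

Lemma vertex_not_midpoint p x : is_vertex K p -> S (p + x) -> S (p - x) -> x = 0.
Proof.
move=> [_ [n hn]] Sp Sm; apply/eqP; apply: contraT => x0.
have h1 : dot n (p + x) < dot n p.
  by apply: hn; [exact: conv_sub|rewrite -subr_eq0 addrAC subrr add0r].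
have h2 : dot n (p - x) < dot n p.
  by apply: hn; [exact: conv_sub|rewrite -subr_eq0 addrAC subrr add0r oppr_eq0].
by move: h1 h2; rewrite dotDr dotBr; lra.
Qed.

(** * Invariance under unimodular maps preserving S *)

Section Map.
Variables M Mi : 'M[R]_3.
Hypotheses (MMi : M *m Mi = 1%:M) (MiM : Mi *m M = 1%:M) (detM : \det M = 1).
Hypotheses (SM : forall x, S x -> S (M *m x)) (SMi : forall x, S x -> S (Mi *m x)).

Lemma conv_map x : K x -> K (M *m x).
Proof.
move=> [m [pt [w [Spt w0 w1 ->]]]]; exists m, (fun i => M *m pt i), w; split=> // [i|].
  exact: SM.
by rewrite mulmx_sumr; apply: eq_bigr => i _; rewrite scalemxAr.
Qed.

(** Normals are covectors, so they move by the transposed inverse; determinant 1 keeps the sides. *)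
Lemma flag_map s a b N : flag s a b N -> flag s (M *m a) (M *m b) (Mi^T *m N).
Proof.
have MK x : M *m (Mi *m x) = x by rewrite mulmxA MMi mul1mx.
have KM x : Mi *m (M *m x) = x by rewrite mulmxA MiM mul1mx.
have detE x y z : det3 (M *m x) (M *m y) (M *m z) = det3 x y z.
  by rewrite det3_mul detM mul1r.
move=> [[Sa Sb ab] [sN Na Nb] h1 [k [Sk Nk hk]] h3]; split.
- split; [exact: SM|exact: SM|].
  by apply: contra ab => /eqP e; rewrite -(KM a) e KM.
- split; rewrite ?dot_mull ?KM // => x Sx.
  by rewrite dot_mull sN //; exact: SMi.
- by move=> x Sx; rewrite dot_mull -{2}(MK x) detE; apply: h1; exact: SMi.
- by exists (M *m k); split; rewrite ?dot_mull ?KM ?detE //; exact: SM.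
- move=> x Sx; rewrite dot_mull -{2}(MK x) detE => Nx D.
  have [t [t0 t1 e]] := h3 _ (SMi Sx) Nx D; exists t; split=> //.
  by rewrite -[LHS]MK e mulmxDr -scalemxAr mulmxBr.
Qed.

Lemma edge_map a b k l : edge_datum K a b k l ->
  edge_datum K (M *m a) (M *m b) (M *m k) (M *m l).
Proof.
have KM x : Mi *m (M *m x) = x by rewrite mulmxA MiM mul1mx.
move=> /edge_flags [N1 [N2 [f1 f2 [Kk N1k Dk] [Kl N2l Dl]]]].
apply: (flags_edge (flag_map f1) (flag_map f2)).
- exact: conv_map.
- by rewrite dot_mull KM.
- by rewrite det3_mul detM mul1r.
- exact: conv_map.
- by rewrite dot_mull KM.
- by rewrite det3_mul detM mul1r.
Qed.

Lemma omega_map a b k l :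
  omega (M *m a) (M *m b) (M *m k) (M *m l) = omega a b k l.
Proof. by rewrite /omega -!mulmxBr !det3_mul detM !mul1r. Qed.

End Map.
End Flags.

(** * Units of the order Z[A] *)

Lemma finite_representatives (X : eqType) (T : finType) (P : X -> Prop) (f : X -> T) :
  exists s : seq X, forall x, P x -> exists y, [/\ y \in s, P y & f y = f x].
Proof.
have /choice [o ho] : forall t : T, exists o : option X,
    forall x, P x -> f x = t -> exists y, [/\ o = Some y, P y & f y = t].
  move=> t; have [[x [Px fx]]|no] := pselect (exists x, P x /\ f x = t).
    by exists (Some x) => _ _ _; exists x.
  by exists None => x Px fx; case: no; exists x.
exists (pmap o (enum T)) => x Px; have [y [oy Py fy]] := ho (f x) x Px erefl.
by exists y; split=> //; rewrite mem_pmap -oy map_f // mem_enum.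
Qed.

Lemma seq_bound (R : realDomainType) (T : eqType) (P : T -> R -> Prop) (s : seq T) :
  (forall x c c', P x c -> c <= c' -> P x c') -> (forall x, exists c, P x c) ->
  exists2 c, 0 < c & forall x, x \in s -> P x c.
Proof.
move=> Pm Pe; elim: s => [|z s [c c0 hc]]; first by exists 1; rewrite ?ltr01.
have [c' hc'] := Pe z.
exists (Num.max c c') => [|x]; first by rewrite lt_max c0.
rewrite inE => /predU1P[->|xs]; first by apply: Pm hc' _; rewrite le_max lexx orbT.
by apply: Pm (hc x xs) _; rewrite le_max lexx.
Qed.

Section Eigen.
Variables (R : realType) (A : 'M[int]_3) (l : 'I_3 -> R) (v : 'I_3 -> 'cV[R]_3).
Notation vec := 'cV[R]_3.
Hypothesis Airr : irreducible_poly (char_poly (ZtoQ A)).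
Hypothesis lpos : forall i, 0 < l i.
Hypothesis linj : injective l.
Hypothesis v_neq0 : forall i, v i != 0.
Hypothesis Av : forall i, ZtoR R A *m v i = l i *: v i.
Implicit Types (M B U : 'M[int]_3) (q z : 'cV[int]_3) (x : vec) (i j : 'I_3).

Local Notation Z2R := (ZtoR R).

Lemma ZtoRM B B' : Z2R (B *m B') = Z2R B *m Z2R B'.
Proof. exact: map_mxM. Qed.
Lemma ZtoRD B B' : Z2R (B + B') = Z2R B + Z2R B'.
Proof. exact: map_mxD. Qed.
Lemma ZtoRZ (n : int) B : Z2R (n *: B) = n%:~R *: Z2R B.
Proof. by apply/matrixP => i j; rewrite !mxE intrM. Qed.
Lemma ZtoR_scalar (n : int) : Z2R n%:M = n%:~R%:M.
Proof. by apply/matrixP => i j; rewrite !mxE rmorphMn. Qed.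
Lemma det_ZtoR B : \det (Z2R B) = (\det B)%:~R.
Proof. exact: det_map_mx. Qed.

(** * Coordinates in the eigenbasis *)

Definition eigen_mx : 'M[R]_3 := \matrix_(r, i) v i r 0.

Lemma eigen_mx_mul (c : vec) : eigen_mx *m c = \sum_i c i 0 *: v i.
Proof.
apply/colP => r; rewrite !mxE summxE; apply: eq_bigr => i _.
by rewrite !mxE mulrC.
Qed.

Lemma eigen_mx_unit : eigen_mx \in unitmx.
Proof.
rewrite unitmxE unitfE -det_tr; apply/negP => /det0P [r r0 hr].
have e0 : \sum_i r 0 i *: v i = 0.
  have := congr1 trmx hr; rewrite trmx_mul trmxK trmx0 eigen_mx_mul => E.
  by rewrite -[RHS]E; apply: eq_bigr => i _; rewrite mxE.
have e1 : \sum_i (r 0 i * l i) *: v i = 0.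
  have := congr1 (mulmx (Z2R A)) e0; rewrite mulmx0 mulmx_sumr => E.
  rewrite -[RHS]E; apply: eq_bigr => i _.
  by rewrite -scalemxAr Av scalerA.
have e2 : \sum_i (r 0 i * l i * l i) *: v i = 0.
  have := congr1 (mulmx (Z2R A)) e1; rewrite mulmx0 mulmx_sumr => E.
  rewrite -[RHS]E; apply: eq_bigr => i _.
  by rewrite -scalemxAr Av scalerA.
(* The product of [A - l j] and [A - l k] kills the two other terms of the relation and multiplies
   the i-th by a nonzero factor. *)
have key i j k : uniq [:: i; j; k] -> r 0 i = 0.
  move=> u; have : (r 0 i * ((l i - l j) * (l i - l k))) *: v i = 0.
    have : \sum_m (r 0 m * ((l m - l j) * (l m - l k))) *: v m = 0.
      rewrite (eq_bigr (fun m => (r 0 m * l m * l m) *: v m - (l j + l k) *: ((r 0 m * l m) *: v m)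
         + (l j * l k) *: (r 0 m *: v m))); last first.
        move=> m _; rewrite !scalerA -scalerBl -scalerDl; congr (_ *: _); ring.
      by rewrite big_split sumrB /= -!scaler_sumr e0 e1 e2 !scaler0 subrr addr0.
    rewrite (bigD1 i) //= big1 ?addr0 // => m mi.
    have /orP[/eqP->|/eqP->] : (m == j) || (m == k).
    - by move: i j k m u mi; do 4 (apply: ord3P => //).
    - by rewrite subrr mul0r mulr0 scale0r.
    - by rewrite subrr !mulr0 scale0r.
  move/eqP; rewrite scaler_eq0 (negPf (v_neq0 i)) orbF !mulf_eq0 !subr_eq0.
  rewrite !(inj_eq linj); move: u; rewrite /= !inE negb_or -andbA => /and3P[/negPf -> /negPf -> _].
  by rewrite !orbF => /eqP.
move/eqP: r0; apply; apply/rowP; apply: ord3P; rewrite mxE.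
- exact: (key 0 1 i2).
- exact: (key 1 0 i2).
- exact: (key i2 0 1).
Qed.

Definition ecoord x i : R := (invmx eigen_mx *m x) i 0.

Lemma coordE x : x = \sum_i ecoord x i *: v i.
Proof. by rewrite -eigen_mx_mul mulmxA mulmxV ?eigen_mx_unit // mul1mx. Qed.

Lemma coord_sum (c : 'I_3 -> R) i : ecoord (\sum_j c j *: v j) i = c i.
Proof.
rewrite (_ : \sum_j _ = eigen_mx *m \col_j c j); last by rewrite eigen_mx_mul; apply: eq_bigr => j _; rewrite mxE.
by rewrite /ecoord mulmxA mulVmx ?eigen_mx_unit // mul1mx mxE.
Qed.

Lemma coordD x y i : ecoord (x + y) i = ecoord x i + ecoord y i.
Proof. by rewrite /ecoord mulmxDr mxE. Qed.
Lemma coordN x i : ecoord (- x) i = - ecoord x i.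
Proof. by rewrite /ecoord mulmxN mxE. Qed.
Lemma coordZ r x i : ecoord (r *: x) i = r * ecoord x i.
Proof. by rewrite /ecoord -scalemxAr mxE. Qed.

Lemma coord_inj x y : (forall i, ecoord x i = ecoord y i) -> x = y.
Proof. by move=> h; rewrite (coordE x) (coordE y); apply: eq_bigr => i _; rewrite h. Qed.

Lemma coord_eigen (M : 'M[R]_3) mu x i :
  (forall j, M *m v j = mu j *: v j) -> ecoord (M *m x) i = mu i * ecoord x i.
Proof.
move=> h; rewrite {1}(coordE x) mulmx_sumr -(coord_sum (fun i => mu i * ecoord x i)).
congr (ecoord _ _); apply: eq_bigr => j _; by rewrite -scalemxAr h scalerA mulrC.
Qed.

Lemma mul_eigen_mx (M : 'M[R]_3) mu : (forall j, M *m v j = mu j *: v j) ->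
  M *m eigen_mx = eigen_mx *m diag_mx (\row_j mu j).
Proof.
move=> h; apply/matrixP => r j; rewrite mul_mx_diag !mxE.
have := congr1 (fun x : vec => x r 0) (h j); rewrite /= !mxE mulrC => <-.
by apply: eq_bigr => s _; rewrite !mxE.
Qed.

Lemma det_eigen_mx_neq0 : \det eigen_mx != 0.
Proof. by have := eigen_mx_unit; rewrite unitmxE unitfE. Qed.

Lemma det_eigen (M : 'M[R]_3) mu : (forall j, M *m v j = mu j *: v j) ->
  \det M = mu 0 * mu 1 * mu i2.
Proof.
move=> /mul_eigen_mx /(congr1 determinant); rewrite !det_mulmx mulrC => /(mulfI det_eigen_mx_neq0) ->.
rewrite det_diag !big_ord_recl big_ord0 mulr1 mulrA !mxE.
by congr (mu _ * mu _ * mu _); apply/val_inj.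
Qed.

Lemma char_poly_eigen (M : 'M[R]_3) mu : (forall j, M *m v j = mu j *: v j) ->
  char_poly M = ('X - (mu 0)%:P) * ('X - (mu 1)%:P) * ('X - (mu i2)%:P).
Proof.
move=> /mul_eigen_mx MV; pose D : 'M[R]_3 := diag_mx (\row_j mu j).
have -> : char_poly M = char_poly D.
  have VC : \det (map_mx polyC eigen_mx) != 0 by rewrite det_map_mx polyC_eq0 det_eigen_mx_neq0.
  apply: (mulIf VC); rewrite [RHS]mulrC /char_poly -!det_mulmx.
  congr (\det _); rewrite /char_poly_mx mulmxBl mulmxBr -scalar_mxC; congr (_ - _).
  by rewrite -!map_mxM MV.
rewrite char_poly_trig ?diag_mx_is_trig // !big_ord_recl big_ord0 mulr1 mulrA.
by rewrite !mxE /=; congr (('X - (mu _)%:P) * ('X - (mu _)%:P) * ('X - (mu _)%:P)); apply/val_inj.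
Qed.

Lemma horner_mx_eigen (M : 'M[R]_3) x mu p : M *m x = mu *: x ->
  horner_mx M p *m x = p.[mu] *: x.
Proof.
move=> h; elim/poly_ind: p => [|p c IH]; first by rewrite rmorph0 mul0mx horner0 scale0r.
rewrite rmorphD rmorphM /= horner_mx_X horner_mx_C -mulmxE mulmxDl -mulmxA h -scalemxAr IH.
by rewrite mul_scalar_mx scalerA -scalerDl !hornerE mulrC.
Qed.

Lemma root_char_poly_eigen (M : 'M[R]_3) x mu : x != 0 -> M *m x = mu *: x ->
  root (char_poly M) mu.
Proof.
move=> x0 h; have := horner_mx_eigen (char_poly M) h.
rewrite Cayley_Hamilton mul0mx => /esym/eqP.
by rewrite scaler_eq0 (negPf x0) orbF.
Qed.

(* q : Z^3 stands for the element q0 + q1 A + q2 A^2 of the order Z[A]; sig q i are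
   its three real embeddings and nrm q its norm. *)
Definition pol q : 'M[int]_3 := (q 0 0)%:M + q 1 0 *: A + q i2 0 *: (A *m A).
Definition sig q i : R := (q 0 0)%:~R + (q 1 0)%:~R * l i + (q i2 0)%:~R * l i ^+ 2.

Lemma pol_eigen q i : Z2R (pol q) *m v i = sig q i *: v i.
Proof.
rewrite /pol !ZtoRD !ZtoRZ ZtoR_scalar ZtoRM !mulmxDl -!scalemxAl -mulmxA Av -scalemxAr Av.
by rewrite mul_scalar_mx !scalerA -!scalerDl /sig expr2 mulrA.
Qed.

Lemma pol_comm q : pol q *m A = A *m pol q.
Proof.
by rewrite /pol !mulmxDl !mulmxDr -!scalemxAl -!scalemxAr scalar_mxC mulmxA.
Qed.

Lemma sigB q q' i : sig (q - q') i = sig q i - sig q' i.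
Proof. by rewrite /sig !mxE !intrB; ring. Qed.

Definition nrm q : int := \det (pol q).

Lemma nrmE q : (nrm q)%:~R = sig q 0 * sig q 1 * sig q i2.
Proof. by rewrite -det_ZtoR; apply: det_eigen => j; exact: pol_eigen. Qed.

(** A nonzero polynomial of degree at most 2 is coprime to the irreducible cubic, so the two have no
    common root [l i]. *)
Lemma sig_eq0 q i : sig q i = 0 -> q = 0.
Proof.
move=> s0; pose p : {poly rat} := \poly_(j < 3) ((q (inord j) 0)%:~R).
have p_root : root (map_poly ratr p) (l i).
  rewrite /root; apply/eqP; rewrite -[RHS]s0 (@horner_coef_wide _ 3); last first.
    by rewrite size_map_poly size_poly.
  rewrite sum3E !coef_map /= !coef_poly /= /sig mulr1 !rmorph_int.
  by congr ((q _ 0)%:~R + (q _ 0)%:~R * l i + (q _ 0)%:~R * _); apply/val_inj; rewrite /= inordK.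
have c_root : root (map_poly ratr (char_poly (ZtoQ A))) (l i).
  rewrite (map_char_poly (ratr : {rmorphism rat -> R})) (_ : map_mx _ _ = Z2R A).
    exact: root_char_poly_eigen (v_neq0 i) (Av i).
  by apply/matrixP => r s; rewrite !mxE rmorph_int.
have [p0|p0] := eqVneq p 0.
  apply/colP => j; have := congr1 (fun P : {poly rat} => P`_j) p0.
  by rewrite /= coef_poly ltn_ord coef0 inord_val mxE => /eqP; rewrite intr_eq0 => /eqP.
have cop : coprimep p (char_poly (ZtoQ A)).
  rewrite /coprimep; apply: contraT => g1.
  have := Airr.2 _ g1 (dvdp_gcdr _ _); rewrite /eqp => /andP[_ h].
  have := dvdp_leq p0 (dvdp_trans h (dvdp_gcdl _ _)); rewrite size_char_poly.
  by move=> le4; have := leq_trans le4 (size_poly _ _).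
have := coprimep_root (_ : coprimep (map_poly ratr p) (map_poly ratr (char_poly (ZtoQ A)))) p_root.
by rewrite coprimep_map cop => /(_ isT); rewrite -[_ == 0]/(root _ _) c_root.
Qed.

Lemma nrm_neq0 q : q != 0 -> nrm q != 0.
Proof.
move=> q0; rewrite -(intr_eq0 R) nrmE !mulf_neq0 //; apply: contra q0 => /eqP;
  by move=> /sig_eq0 ->.
Qed.

Lemma sig_gt0 q i : q != 0 -> 0 < `|sig q i|.
Proof. by move=> q0; rewrite normr_gt0; apply: contra q0 => /eqP/sig_eq0 ->. Qed.

Lemma nrm_ge1 q : q != 0 -> 1 <= `|sig q 0| * `|sig q 1| * `|sig q i2|.
Proof.
move=> /nrm_neq0 n0; rewrite -!normrM -nrmE -intr_norm ler1z.
by move: n0; lia.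
Qed.

(** * Elements of Z[A] with balanced embeddings *)

Definition sig_bound : R := 1 + \sum_i (1 + l i + l i ^+ 2).

Lemma sig_bound_gt i : 1 + l i + l i ^+ 2 < sig_bound.
Proof.
rewrite /sig_bound (bigD1 i) //=.
suff : 0 <= \sum_(j < 3 | j != i) (1 + l j + l j ^+ 2) by lra.
by apply: sumr_ge0 => j _; rewrite !addr_ge0 ?sqr_ge0 ?ler01 // ltW.
Qed.

Lemma sig_bound_ge1 : 1 <= sig_bound.
Proof.
have := sig_bound_gt 0; have := lpos 0; have := sqr_ge0 (l 0); lra.
Qed.

(** For coefficients in [0, N) the i-th embedding lies in [0, [sig_bound] N), which is cut into
    [k i] equal pieces. Two of the N^3 vectors share all three pieces, and their difference is
    [q]. *)
Lemma sig_pigeonhole (k : 'I_3 -> nat) (N : nat) : (forall i, (0 < k i)%N) ->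
  (k 0%R * k 1%R * k i2 < N ^ 3)%N ->
  exists2 q, q != 0 & forall i, `|sig q i| * (k i)%:R <= sig_bound * N%:R.
Proof.
move=> k_gt0 ltN; have N0 : (0 < N)%N by case: N ltN.
have L0 : 0 < sig_bound by apply: lt_le_trans sig_bound_ge1.
have LN0 : 0 < sig_bound * N%:R by rewrite mulr_gt0 ?ltr0n.
have kR i : 0 < (k i)%:R :> R by rewrite ltr0n.
pose Q (f : {ffun 'I_3 -> 'I_N}) : 'cV[int]_3 := \col_i (f i : nat)%:Z.
pose b f i := sig (Q f) i * (k i)%:R / (sig_bound * N%:R).
have sE f i : sig (Q f) i = (f 0 : nat)%:R + (f 1 : nat)%:R * l i + (f i2 : nat)%:R * l i ^+ 2.
  by rewrite /sig !mxE.
have b_ge0 f i : 0 <= b f i.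
  rewrite divr_ge0 ?(ltW LN0) // mulr_ge0 // sE.
  by rewrite !addr_ge0 ?mulr_ge0 ?sqr_ge0 ?(ltW (lpos i)).
have b_lt f i : (Num.truncn (b f i) < k i)%N.
  rewrite truncn_lt_nat // ltr_pdivrMr // mulrC ltr_pM2l // sE.
  apply: (@le_lt_trans _ _ ((1 + l i + l i ^+ 2) * N%:R)); last by rewrite ltr_pM2r ?ltr0n ?sig_bound_gt.
  have h (j : 'I_N) : (j : nat)%:R <= N%:R :> R by rewrite ler_nat ltnW.
  have := h (f 0); have := ler_wpM2r (ltW (lpos i)) (h (f 1)).
  have := ler_wpM2r (sqr_ge0 (l i)) (h (f i2)); lra.
pose F f : 'I_(k 0) * 'I_(k 1) * 'I_(k i2) :=
  (Ordinal (b_lt f 0), Ordinal (b_lt f 1), Ordinal (b_lt f i2)).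
have /injectivePn [f [g fg eF]] :
    ~~ injectiveb F.
  apply/negP => /injectiveP/leq_card.
  by rewrite !card_prod card_ffun !card_ord leqNgt ltN.
have [e0 e1 e2] : [/\ Num.truncn (b f 0) = Num.truncn (b g 0),
    Num.truncn (b f 1) = Num.truncn (b g 1) & Num.truncn (b f i2) = Num.truncn (b g i2)].
  by move: eF; rewrite /F => -[].
exists (Q f - Q g).
  rewrite subr_eq0; apply: contra fg => /eqP/colP e; apply/eqP/ffunP => i.
  by have := e i; rewrite !mxE => -[]/val_inj.
have te i : Num.truncn (b f i) = Num.truncn (b g i) by move: i; apply: ord3P.
move=> i; rewrite sigB -[X in _ * X]gtr0_norm // -normrM mulrBl.
have -> : sig (Q f) i * (k i)%:R - sig (Q g) i * (k i)%:R = (b f i - b g i) * (sig_bound * N%:R).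
  by rewrite /b; field; rewrite !gt_eqF ?ltr0n.
rewrite normrM [X in _ * X]gtr0_norm // ler_piMl ?(ltW LN0) //.
have := truncn_itv (b_ge0 f i); have := truncn_itv (b_ge0 g i); rewrite te -natr1.
by move=> /andP[h1 h2] /andP[h3 h4]; rewrite ler_norml; lra.
Qed.

(* Minkowski's theorem for the boxes |sig q i| <= lambda / t i, by the box principle. *)
Lemma sig_balanced (t : 'I_3 -> R) : (forall i, 0 < t i) -> exists q,
  [/\ q != 0, `|sig q 0| * `|sig q 1| * `|sig q i2| <= 16 * sig_bound ^+ 3 &
      forall i j, `|sig q i| * t i <= 16 * sig_bound ^+ 3 * (`|sig q j| * t j)].
Proof.
(* The claim is homogeneous in [t]; scaling by M makes every weight at least 1, so that rounding
   down loses at most a factor 2. *)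
move=> t0; pose M := (Num.truncn (\sum_i (t i)^-1)).+1.
have M0 : 0 < M%:R :> R by rewrite ltr0n.
have Mt i : 1 <= M%:R * t i.
  rewrite -ler_pdivrMr // mul1r; apply: le_trans (ltW (truncnS_gt _)).
  by rewrite (bigD1 i) //= lerDl sumr_ge0 // => j _; rewrite invr_ge0 ltW.
pose k i := Num.truncn (M%:R * t i).
have k0 i : (0 < k i)%N by rewrite truncn_gt0.
have kR i : (k i)%:R <= M%:R * t i <= 2 * (k i)%:R.
  have := truncn_itv (le_trans ler01 (Mt i)); rewrite -/(k i) -natr1 => /andP[-> h] /=.
  have : 1 <= (k i)%:R :> R by rewrite ler1n.
  by lra.
pose P N := (k 0%R * k 1%R * k i2 < N ^ 3)%N.
have exP : exists N, P N.
  exists (k 0%R * k 1%R * k i2).+1; rewrite /P expnS.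
  by apply: leq_trans (leq_pmulr _ _); rewrite // expn_gt0.
(* The least N for which the box principle applies; since [N <= 2 * N.-1], its cube exceeds the
   number of boxes at most 8 times. *)
case: (ex_minnP exP) => N PN minN.
have N1 : (1 < N)%N.
  rewrite ltnNge; apply/negP => N1; move: PN; rewrite /P ltnNge => /negP; apply.
  apply: (@leq_trans 1); first by rewrite -(exp1n 3) leq_exp2r.
  by rewrite !muln_gt0 !k0.
have le8 : (N ^ 3 <= 8 * (k 0%R * k 1%R * k i2))%N.
  have : ~~ P N.-1 by apply/negP => /minN; rewrite leqNgt prednK ?leqnn // ltnW.
  rewrite /P -leqNgt => h; apply: (@leq_trans (8 * N.-1 ^ 3)); last by rewrite leq_mul2l.
  have : (N <= 2 * N.-1)%N by lia.
  by rewrite -(leq_exp2r _ _ (isT : 0 < 3)%N) expnMn.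
have [q q0 hq] := sig_pigeonhole k0 PN; exists q.
have L1 := sig_bound_ge1.
pose s i : R := `|sig q i|.
have s0 i : 0 < s i by exact: sig_gt0.
have s1 : 1 <= s 0 * s 1 * s i2 by exact: nrm_ge1.
have le8R : N%:R ^+ 3 <= 8 * ((k 0)%:R * (k 1)%:R * (k i2)%:R) :> R.
  by rewrite -natrX -!natrM ler_nat.
have NR : 0 < N%:R :> R by rewrite ltr0n ltnW.
pose p i := s i * (k i)%:R.
have p0 i : 0 < p i by rewrite mulr_gt0 // ltr0n.
have ple i : p i <= sig_bound * N%:R by exact: hq.
have prodp : N%:R ^+ 3 <= 8 * (p 0 * p 1 * p i2).
  apply: le_trans le8R _; rewrite ler_pM2l //.
  have -> : p 0 * p 1 * p i2 = (s 0 * s 1 * s i2) * ((k 0)%:R * (k 1)%:R * (k i2)%:R) by rewrite /p; ring.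
  by rewrite ler_peMl // !mulr_ge0.
(* Three factors bounded above whose product is bounded below are each bounded below. *)
have aux (a b c : R) : 0 < a -> 0 < b -> 0 < c -> b <= sig_bound * N%:R -> c <= sig_bound * N%:R ->
    N%:R ^+ 3 <= 8 * (a * b * c) -> N%:R <= 8 * sig_bound ^+ 2 * a.
  move=> a0 b0 c0 bL cL h.
  have bc : b * c <= (sig_bound * N%:R) * (sig_bound * N%:R) by rewrite ler_pM // ltW.
  have : N%:R * N%:R ^+ 2 <= (8 * sig_bound ^+ 2 * a) * N%:R ^+ 2.
    rewrite -exprS; apply: le_trans h _.
    have := ler_wpM2l (ltW a0) bc; lra.
  by rewrite ler_pM2r // exprn_gt0.
have pge i : N%:R <= 8 * sig_bound ^+ 2 * p i.
  move: i; apply: ord3P.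
  - by apply: (aux _ (p 1) (p i2)).
  - by apply: (aux _ (p 0) (p i2)) => //; rewrite [p 1 * _]mulrC.
  - by apply: (aux _ (p 0) (p 1)) => //; rewrite -mulrA [p i2 * _]mulrC.
split=> //.
  have kk : 0 < (k 0)%:R * (k 1)%:R * (k i2)%:R :> R by rewrite !mulr_gt0 ?ltr0n.
  rewrite -(ler_pM2r kk).
  have -> : `|sig q 0| * `|sig q 1| * `|sig q i2| * ((k 0)%:R * (k 1)%:R * (k i2)%:R)
    = p 0 * p 1 * p i2 by rewrite /p /s; ring.
  apply: (@le_trans _ _ ((sig_bound * N%:R) * (sig_bound * N%:R) * (sig_bound * N%:R))).
    have p01 := ler_pM (ltW (p0 0)) (ltW (p0 1)) (ple 0) (ple 1).
    by apply: ler_pM p01 (ple i2); rewrite ?mulr_ge0 // ltW.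
  have L3 : 0 <= sig_bound ^+ 3 by rewrite exprn_ge0 // (le_trans ler01).
  have := ler_wpM2l L3 le8R; have := mulr_ge0 L3 (ltW kk); lra.
(* In the constant 16, a factor 2 comes from rounding and 8 from [pge]. *)
move=> i j; rewrite -(ler_pM2l M0).
have -> : M%:R * (`|sig q i| * t i) = s i * (M%:R * t i) by rewrite mulrCA.
have -> : M%:R * (16 * sig_bound ^+ 3 * (`|sig q j| * t j)) = 16 * sig_bound ^+ 3 * (s j * (M%:R * t j)).
  by rewrite /s; ring.
have /andP[_ h1] := kR i; have /andP[h2 _] := kR j.
have a1 : s i * (M%:R * t i) <= 2 * (sig_bound * N%:R).
  by apply: le_trans (ler_wpM2l (ltW (s0 i)) h1) _; rewrite mulrCA ler_pM2l // ple.
have a2 : p j <= s j * (M%:R * t j) by rewrite ler_wpM2l // ltW.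
have L0 : 0 <= sig_bound by apply: le_trans L1.
have a3 := ler_wpM2l L0 (pge j).
have L3 : 0 <= sig_bound ^+ 3 by rewrite exprn_ge0.
have := ler_wpM2l L3 a2.
lra.
Qed.

(** * Units as quotients of elements of equal norm *)

Lemma polD q z : pol (q + z) = pol q + pol z.
Proof.
apply/matrixP => r s; rewrite /pol !mxE !mulrDl mulrnDl; ring.
Qed.

Lemma polZ (n : int) q : pol (n *: q) = n *: pol q.
Proof. by apply/matrixP => r s; rewrite /pol !mxE -mulrnAr; ring. Qed.

(* With d = nrm q' and Y = pol q', U = 1 + pol z adj(Y) gives U Y = Y + d pol z = pol q. *)
Lemma unit_quotient q q' z : q' != 0 -> nrm q = nrm q' -> q - q' = nrm q' *: z ->
  exists U, [/\ U *m pol q' = pol q, \det U = 1 & U *m A = A *m U].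
Proof.
move=> q'0 en ez; have n0 := nrm_neq0 q'0.
pose U := 1%:M + pol z *m \adj (pol q').
have UP : U *m pol q' = pol q.
  rewrite /U mulmxDl mul1mx -mulmxA mul_adj_mx mul_mx_scalar -polZ -/(nrm q') -ez -polD.
  by rewrite addrC subrK.
exists U; split=> //.
  by apply: (mulIf n0); rewrite -det_mulmx UP mul1r.
(* Commutation is checked after multiplication by Y, which [adj(Y)] then cancels up to the nonzero
   integer d. *)
have e0 : (U *m A - A *m U) *m pol q' = 0.
  by rewrite mulmxBl -!mulmxA -pol_comm UP mulmxA UP pol_comm subrr.
have := congr1 (mulmx^~ (\adj (pol q'))) e0.
rewrite -mulmxA mul_mx_adj mul0mx mul_mx_scalar => e.
apply/eqP; rewrite -subr_eq0; apply/eqP/matrixP => r s.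
move/matrixP/(_ r s): e; rewrite [LHS]mxE [RHS]mxE => /eqP.
by rewrite mulf_eq0 (negPf n0) => /eqP ->; rewrite mxE.
Qed.

Definition unit_act B (mu : 'I_3 -> R) := [/\ pos_dirichlet R A B, \det B = 1,
  forall i, Z2R B *m v i = mu i *: v i, forall i, 0 < mu i & mu 0 * mu 1 * mu i2 = 1].

Lemma unit_square U mu : \det U = 1 -> U *m A = A *m U ->
  (forall i, Z2R U *m v i = mu i *: v i) -> (forall i, mu i != 0) ->
  unit_act (U *m U) (fun i => mu i ^+ 2).
Proof.
move=> dU UA Umu mu0.
have UUmu i : Z2R (U *m U) *m v i = mu i ^+ 2 *: v i.
  by rewrite ZtoRM -mulmxA Umu -scalemxAr Umu scalerA expr2.
have dUU : \det (U *m U) = 1 by rewrite det_mulmx dU mulr1.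
have pos i : 0 < mu i ^+ 2 by rewrite lt_def sqr_ge0 sqrf_eq0 mu0.
split=> //; last by rewrite -(det_eigen UUmu) det_ZtoR dUU.
split.
- by rewrite unitmxE dUU unitr1.
- by rewrite -!mulmxE -mulmxA UA mulmxA UA mulmxA.
- exists (mu 0 ^+ 2), (mu 1 ^+ 2), (mu i2 ^+ 2); split=> //.
  exact: (char_poly_eigen UUmu).
Qed.

(* Dirichlet's unit theorem in the form: the unit group acts cocompactly on the rays
   of the positive octant. *)
Lemma unit_balanced : exists2 C, 0 < C & forall t : 'I_3 -> R, (forall i, 0 < t i) ->
  exists B mu, unit_act B mu /\ forall i j, mu i * t i <= C * (mu j * t j).
Proof.
pose C1 := 16 * sig_bound ^+ 3.
have L0 : 0 < sig_bound by apply: lt_le_trans sig_bound_ge1.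
have C10 : 0 < C1 by rewrite mulr_gt0 // exprn_gt0.
pose m := (Num.truncn C1).+1.
pose P q := q != 0 /\ `|nrm q| <= m%:Z.
(* The colour records the norm, shifted by m to be nonnegative, and the coefficients modulo [m!],
   which every nonzero norm of absolute value at most m divides. Equal colours thus meet the
   hypotheses of [unit_quotient]. *)
pose color q : 'I_(2 * m).+1 * {ffun 'I_3 -> 'I_(m`!).+1} :=
  (inord (absz (nrm q + m%:Z)%R), [ffun i => inord (absz (q i 0%R %% m`!)%Z)]).
have [s hs] := finite_representatives P color.
(* Dividing by one of finitely many representatives distorts the balance by a bounded factor
   only. *)
pose bound q (c : R) := q != 0 -> forall i j, `|sig q i| <= c * `|sig q j|.
have [|q|C2 C20 hC2] := @seq_bound R _ bound s.
- move=> q c c' h cc q0 i j; apply: le_trans (h q0 i j) _.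
  by rewrite ler_wpM2r.
- exists (\sum_i \sum_j `|sig q i| / `|sig q j|) => q0 i j.
  rewrite -ler_pdivrMr ?sig_gt0 // (bigD1 i) //= (bigD1 j) //= -addrA lerDl.
  by rewrite addr_ge0 // sumr_ge0 // => *; rewrite ?sumr_ge0 // => *; rewrite divr_ge0.
exists ((C2 * C1) ^+ 2); first by rewrite exprn_gt0 // mulr_gt0.
(* Square roots of the weights compensate for squaring the unit at the end. *)
move=> t t0; pose u i := Num.sqrt (t i).
have u0 i : 0 < u i by rewrite sqrtr_gt0.
have [q [q0 qn qb]] := sig_balanced u0.
have Pq : P q.
  split=> //; rewrite -(ler_int R) intr_norm nrmE !normrM; apply: le_trans qn _.
  by rewrite ltW // truncnS_gt.
have [q' [q's [q'0 q'n] ec]] := hs q Pq.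
have en : nrm q = nrm q'.
  move: ec => /(congr1 fst)/(congr1 val) /=; case: Pq => _ qn'.
  by rewrite !inordK; lia.
have em i : (q i 0%R = q' i 0%R %[mod m`!])%Z.
  have fpos : 0 < m`!%:Z by have := fact_gt0 m; lia.
  have fne : m`!%:Z != 0 by rewrite gt_eqF.
  have /ffunP/(_ i) := congr1 snd ec; rewrite /= !ffunE => /(congr1 val) /=.
  have b1 := modz_ge0 (q i 0) fne; have b2 := ltz_pmod (q i 0) fpos.
  have b3 := modz_ge0 (q' i 0) fne; have b4 := ltz_pmod (q' i 0) fpos.
  rewrite !inordK; lia.
have n0 := nrm_neq0 q'0.
have /choice [z hz] : forall i, exists z : int, q i 0 - q' i 0 = nrm q' * z.
  move=> i; have : (nrm q' %| q i 0%R - q' i 0%R)%Z.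
    have : (m`! %| q i 0%R - q' i 0%R)%Z by rewrite -eqz_mod_dvd; apply/eqP.
    by apply: dvdz_trans; rewrite dvdzE /=; apply: dvdn_fact; lia.
  by move=> /dvdzP [z ->]; exists z; rewrite mulrC.
have [|U [UP dU UA]] := @unit_quotient q q' (\col_i z i) q'0 en.
  by apply/colP => i; rewrite !mxE hz.
have sq0 i : sig q' i != 0 by rewrite -normr_gt0 sig_gt0.
have Umu i : Z2R U *m v i = (sig q i / sig q' i) *: v i.
  apply: (scalerI (sq0 i)); rewrite scalerA mulrC divfK // scalemxAr -!pol_eigen.
  by rewrite mulmxA -ZtoRM UP.
have mu0 i : sig q i / sig q' i != 0.
  by rewrite mulf_neq0 ?invr_neq0 // -normr_gt0 sig_gt0.
exists (U *m U), (fun i => (sig q i / sig q' i) ^+ 2); split; first exact: unit_square.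
move=> i j.
have tE k : (sig q k / sig q' k) ^+ 2 * t k = (`|sig q k| * u k / `|sig q' k|) ^+ 2.
  rewrite -(sqr_sqrtr (ltW (t0 k))) -/(u k) -[in LHS]real_normK ?num_real //.
  by rewrite normrM normfV -exprMn mulrAC.
rewrite !tE -exprMn ler_pXn2r ?nnegrE ?mulr_ge0 ?invr_ge0 ?(ltW (u0 _)) ?(ltW C10) ?(ltW C20) ?(ltW L0) //.
rewrite ler_pdivrMr ?sig_gt0 //; apply: le_trans (qb i j) _; rewrite -/C1.
have := hC2 q' q's q'0 j i => h.
have -> : C2 * C1 * (`|sig q j| * u j / `|sig q' j|) * `|sig q' i| =
   C1 * (`|sig q j| * u j) * (C2 * `|sig q' i| / `|sig q' j|) by ring.
have h' : 1 <= C2 * `|sig q' i| / `|sig q' j| by rewrite ler_pdivlMr ?sig_gt0 // mul1r.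
by apply: ler_peMr h'; rewrite mulr_ge0 ?(ltW C10) // mulr_ge0 // ltW.
Qed.

End Eigen.

(** * The sail of an irreducible matrix *)

Section Klein.
Variables (R : realType) (A : 'M[int]_3) (l : 'I_3 -> R) (v : 'I_3 -> 'cV[R]_3).
Notation vec := 'cV[R]_3.
Hypothesis Airr : irreducible_poly (char_poly (ZtoQ A)).
Hypothesis lpos : forall i, 0 < l i.
Hypothesis linj : injective l.
Hypothesis v_neq0 : forall i, v i != 0.
Hypothesis Av : forall i, ZtoR R A *m v i = l i *: v i.
Implicit Types (M B U : 'M[int]_3) (x p N : vec) (i j : 'I_3).

Local Notation Z2R := (ZtoR R).
Local Notation crd := (ecoord v).
Local Notation uact := (unit_act A v).

Lemma unit_small e i : 0 < e -> exists B mu, uact B mu /\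
  forall j, j != i -> mu j <= e.
Proof.
move=> e0; have [C C0 hC] := unit_balanced Airr lpos linj v_neq0 Av.
(* If [e < mu j], balance gives [e < C * mu k] and [e < C * mu i * tau]. As the eigenvalues have
   product 1, multiplying yields e^3 < C^2 tau, which this choice of [tau] contradicts. *)
pose tau := e ^+ 3 / C ^+ 2.
have tau0 : 0 < tau by rewrite divr_gt0 ?exprn_gt0.
have [|B [mu [Bmu hmu]]] := hC (fun j => if j == i then tau else 1).
  by move=> j; case: ifP.
exists B, mu; split=> // j ji; rewrite leNgt; apply/negP => ltj.
have [_ _ _ mu0 mu1] := Bmu.
have [k [ki kj]] : exists k, k != i /\ k != j.
  by move: i j {hmu ltj} ji; do 2 (apply: ord3P => //); move=> _;
    (by exists 0) || (by exists 1) || (by exists i2).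
have prod : mu i * mu j * mu k = 1.
  rewrite -[RHS]mu1; move: i j k ji ki kj {hmu ltj}.
  by do 3 (apply: ord3P => //); move=> *; ring.
have h1 : e < C * mu k.
  by have := hmu j k; rewrite (negPf ji) (negPf ki) !mulr1; apply: lt_le_trans.
have h2 : e < C * (mu i * tau).
  by have := hmu j i; rewrite (negPf ji) eqxx mulr1; apply: lt_le_trans.
have : e * e * e < mu j * (C * mu k) * (C * (mu i * tau)).
  by rewrite !ltr_pM // ?mulr_ge0 ?(ltW e0).
have -> : mu j * (C * mu k) * (C * (mu i * tau)) = (mu i * mu j * mu k) * (C ^+ 2 * tau) by ring.
rewrite prod mul1r /tau mulrCA divff ?mulr1 ?expf_neq0 ?gt_eqF //.
by rewrite -expr2 -exprSr ltxx.
Qed.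

(** * The integer points of the cone *)

Definition klein_pt x := [/\ int_pt x, cone (v 0) (v 1) (v i2) x & x != 0].
Local Notation S := klein_pt.

Lemma coneE x : cone (v 0) (v 1) (v i2) x <-> forall i, 0 <= crd x i.
Proof.
split=> [[a1 [a2 [a3 [h1 h2 h3 ->]]]]|h].
  pose a (i : 'I_3) := nth 0 [:: a1; a2; a3] i.
  have -> : a1 *: v 0 + a2 *: v 1 + a3 *: v i2 = \sum_i a i *: v i by rewrite sum3E.
  by move=> i; rewrite (coord_sum linj v_neq0 Av); move: i; apply: ord3P.
exists (crd x 0), (crd x 1), (crd x i2); split=> //.
by rewrite -(sum3E (fun i => crd x i *: v i)) -(coordE linj v_neq0 Av).
Qed.

Lemma int_mul B x : int_pt x -> int_pt (Z2R B *m x).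
Proof.
move=> h i; rewrite mxE rpred_sum // => j _; rewrite mxE rpredM ?h //.
exact: intr_int.
Qed.

Lemma norm_coord : exists2 c, 0 < c & forall x r, `|x r 0| <= c * \sum_i `|crd x i|.
Proof.
exists (1 + \sum_i \sum_r `|v i r 0|).
  by rewrite ltr_pwDl // sumr_ge0 // => i _; rewrite sumr_ge0.
move=> x r; rewrite {1}(coordE linj v_neq0 Av x) summxE mulr_sumr.
apply: le_trans (ler_norm_sum _ _ _) _; apply: ler_sum => i _.
rewrite mxE normrM mulrC ler_wpM2r // (bigD1 i) //= (bigD1 r) //=.
set s1 := \sum_(_ | _) _; set s2 := \sum_(_ | _) _.
have s10 : 0 <= s1 by apply: sumr_ge0.
have s20 : 0 <= s2 by apply: sumr_ge0 => j _; apply: sumr_ge0.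
by lra.
Qed.

(* If one coordinate of x vanished, a unit contracting the other two would map x
   to a nonzero integer point of norm less than 1. *)
Lemma klein_pos x i : S x -> 0 < crd x i.
Proof.
move=> [xint /coneE xc x0]; rewrite lt_def xc andbT; apply/eqP => xi.
have [c c0 hc] := norm_coord.
pose s := \sum_j `|crd x j|.
have s0 : 0 <= s by apply: sumr_ge0.
pose e := (c * (s + 1) + 1)^-1.
have d0 : 0 < c * (s + 1) + 1 by rewrite ltr_wpDl ?ltr01 // mulr_ge0 ?(ltW c0) ?addr_ge0.
have e0 : 0 < e by rewrite invr_gt0.
have [B [mu [[_ dB Bv mu0 _] hmu]]] := unit_small i e0.
have small r : `|(Z2R B *m x) r 0| < 1.
  apply: le_lt_trans (hc _ _) _.
  apply: (@le_lt_trans _ _ (c * (e * s))).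
    rewrite ler_pM2l // /s mulr_sumr; apply: ler_sum => j _.
    rewrite (coord_eigen linj v_neq0 Av _ _ Bv) normrM gtr0_norm //.
    have [->|ji] := eqVneq j i; first by rewrite xi normr0 !mulr0.
    by rewrite ler_wpM2r // hmu.
  by rewrite mulrCA mulrC -ltr_pdivlMr ?invr_gt0 // invrK mul1r; lra.
have Bx0 : Z2R B *m x = 0.
  apply/colP => r; rewrite [RHS]mxE; have /intrP [z ez] := int_mul B xint r.
  have := small r; rewrite ez -intr_norm -[1]/(1%:~R) ltr_int => z1.
  by have -> : z = 0 by lia.
move/eqP: x0; apply; apply: (coord_inj linj v_neq0 Av) => j.
have := coord_eigen linj v_neq0 Av x j Bv; rewrite Bx0 => /eqP.
rewrite /ecoord mulmx0 mxE eq_sym mulf_eq0 gt_eqF //= => /eqP -> //.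
Qed.

Lemma kleinP x : int_pt x -> (forall i, 0 < crd x i) -> S x.
Proof.
move=> xint h; split=> //; first by apply/coneE => i; exact: ltW.
by apply: contraTneq (h 0) => ->; rewrite /ecoord mulmx0 mxE ltxx.
Qed.

Lemma klein_dbl x : S x -> S (2 *: x).
Proof.
move=> [xint xc x0]; split; last by rewrite scaler_eq0 negb_or x0 pnatr_eq0.
  by move=> i; rewrite mxE rpredM ?rpred_nat ?xint.
by apply/coneE => i; rewrite coordZ mulr_ge0 //; move/coneE: xc.
Qed.

Lemma klein_unit B mu x : uact B mu -> S x -> S (Z2R B *m x).
Proof.
move=> [_ _ Bv mu0 _] Sx; apply: kleinP; first by apply: int_mul; case: Sx.
by move=> i; rewrite (coord_eigen linj v_neq0 Av _ _ Bv) mulr_gt0 // klein_pos.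
Qed.

Lemma klein_nat x (n : nat) : S x -> int_pt (n%:R *: x).
Proof. by move=> [h _ _] i; rewrite mxE rpredM ?rpred_nat ?h. Qed.

Lemma delta_int j : int_pt (delta_mx j 0 : vec).
Proof. by move=> i; rewrite mxE rpred_nat. Qed.

Lemma int_ptD x y : int_pt x -> int_pt y -> int_pt (x + y).
Proof. by move=> h h' i; rewrite mxE rpredD ?h ?h'. Qed.
Lemma int_ptN x : int_pt x -> int_pt (- x).
Proof. by move=> h i; rewrite mxE rpredN h. Qed.

(** [p] is interior to the cone, so a large multiple of it plus or minus a unit vector stays in S;
    both signs together kill each entry of [n]. *)
Lemma klein_open n p : S p -> dot n p = 0 -> (forall x, S x -> 0 <= dot n x) -> n = 0.
Proof.
move=> Sp np h; apply/colP => r; rewrite mxE.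
pose e : vec := delta_mx r 0.
have ne : dot n e = n r 0.
  by rewrite /dot mxE (bigD1 r) //= big1 ?addr0 ?mxE ?eqxx ?mulr1 // => j jr; rewrite !mxE (negPf jr) mulr0.
pose M := (Num.truncn (\sum_i `|crd e i| / crd p i)).+1.
have big i : `|crd e i| < M%:R * crd p i.
  rewrite -ltr_pdivrMr ?klein_pos //; apply: le_lt_trans (truncnS_gt _).
  by rewrite (bigD1 i) //= lerDl sumr_ge0 // => j _; rewrite divr_ge0 // ltW // klein_pos.
have in_S x : int_pt x -> (forall i, crd x i = crd e i \/ crd x i = - crd e i) ->
    0 <= dot n x.
  move=> xint hx; have : S (M%:R *: p + x).
    apply: kleinP; first by apply: int_ptD => //; exact: klein_nat.
    move=> i; rewrite coordD coordZ; have := big i; rewrite ltr_norml => /andP[h1 h2].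
    by case: (hx i) => ->; lra.
  by move=> /h; rewrite dotDr dotZr np mulr0 add0r.
have h1 := in_S e (delta_int r) (fun i => or_introl erefl).
have := in_S (- e) (int_ptN (delta_int r)) (fun i => or_intror (coordN _ _ _)).
by rewrite dotNr; move: h1; rewrite ne; lra.
Qed.

Lemma dot_coord N x : dot N x = \sum_i dot N (v i) * crd x i.
Proof.
rewrite {1}(coordE linj v_neq0 Av x) dot_sumr; apply: eq_bigr => i _.
by rewrite dotZr mulrC.
Qed.

(* This is what makes the sail locally finite. *)
Lemma klein_supp_bound a : S a -> exists2 c, 0 < c &
  forall N, supp S N -> dot N a = 1 -> forall x, S x -> forall i, `|x i 0| <= c * dot N x.
Proof.
move=> Sa; have ap i := klein_pos i Sa.
(* n_i = N(v_i) a_i sum to 1, and evaluating N at B a with B contracting all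
   directions but the i-th bounds n_i below *)
have low N B mu : supp S N -> uact B mu -> 1 <= \sum_i mu i * (dot N (v i) * crd a i).
  move=> sN Bmu; have := sN _ (klein_unit Bmu Sa); rewrite dot_coord.
  have [_ _ Bv _ _] := Bmu; under eq_bigr do rewrite (coord_eigen linj v_neq0 Av _ _ Bv) mulrCA.
  by [].
(* The unit makes the terms other than the i-th add up to less than 1, while the total is at least
   1. *)
have pos N i : supp S N -> 0 < dot N (v i).
  move=> sN; rewrite -(pmulr_lgt0 _ (ap i)).
  pose s := \sum_(j | j != i) `|dot N (v j) * crd a j|.
  have s0 : 0 <= s by apply: sumr_ge0.
  have e0 : 0 < (s + 1)^-1 by rewrite invr_gt0 ltr_wpDl.
  have [B [mu [Bmu hmu]]] := unit_small i e0; have [_ _ _ mu0 _] := Bmu.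
  have := low N B mu sN Bmu; rewrite (bigD1 i) //= => h.
  have le1 : \sum_(j | j != i) mu j * (dot N (v j) * crd a j) <= (s + 1)^-1 * s.
    rewrite /s mulr_sumr; apply: ler_sum => j ji.
    apply: le_trans (ler_norm _) _; rewrite normrM gtr0_norm // ler_wpM2r //.
    exact: hmu.
  have lt1 : (s + 1)^-1 * s < 1 by rewrite mulrC ltr_pdivrMr ?mul1r; lra.
  by rewrite -(pmulr_rgt0 _ (mu0 i)); lra.
have half_gt0 : 0 < 2^-1 :> R by rewrite invr_gt0.
(* The n_j are positive with sum 1. Halving those with j different from i leaves at least 1/2 for
   [mu i] n_i, a bound that does not depend on N. *)
have /choice [k hk] : forall i, exists k : R, 0 < k /\
    forall N, supp S N -> dot N a = 1 -> k <= dot N (v i).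
  move=> i; have [B [mu [Bmu hmu]]] := unit_small i half_gt0.
  have [_ _ _ mu0 _] := Bmu.
  exists (2 * mu i * crd a i)^-1; split; first by rewrite invr_gt0 !mulr_gt0.
  move=> N sN Na; have := low N B mu sN Bmu; rewrite (bigD1 i) //=.
  have := dot_coord N a; rewrite Na (bigD1 i) //=.
  set s1 := \sum_(j | _) _; set s2 := \sum_(j | _) _ => e1 h.
  have le2 : s2 <= 2^-1 * s1.
    rewrite /s2 mulr_sumr; apply: ler_sum => j ji; rewrite ler_wpM2r ?hmu //.
    by rewrite mulr_ge0 ?(ltW (ap j)) // ltW // pos.
  have n0 : 0 < dot N (v i) * crd a i by rewrite mulr_gt0 // pos.
  have d0 : 0 < 2 * mu i * crd a i by rewrite !mulr_gt0.
  rewrite -[leLHS]mul1r ler_pdivrMr //; lra.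
have [c c0 hc] := norm_coord.
exists (c * \sum_i (k i)^-1).
  rewrite mulr_gt0 // (bigD1 0) //= ltr_pwDl ?invr_gt0 ?(hk 0).1 //.
  by apply: sumr_ge0 => j _; rewrite invr_ge0 ltW // (hk j).1.
move=> N sN Na x Sx r; apply: le_trans (hc x r) _.
rewrite -mulrA ler_pM2l // mulr_suml; apply: ler_sum => i _.
have xp := klein_pos i Sx; have [k0 kN] := hk i.
rewrite gtr0_norm // mulrC ler_pdivlMr // mulrC dot_coord (bigD1 i) //=.
apply: (@le_trans _ _ (dot N (v i) * crd x i)); first by rewrite ler_pM2r // kN.
by rewrite lerDl sumr_ge0 // => j _; rewrite mulr_ge0 // ltW ?pos // klein_pos.
Qed.

(** * Action of the units on the sail *)

Local Notation K := (conv S).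

(** A matrix commuting with [A] preserves its one-dimensional eigenspaces. The determinant is 1 or
    -1 and a product of positive eigenvalues. *)
Lemma dirichlet_unit_act B : pos_dirichlet R A B -> exists mu, uact B mu.
Proof.
move=> Bd; have [Bu BA [m1 [m2 [m3 [m10 m20 m30 cB]]]]] := Bd.
pose mu i := crd (Z2R B *m v i) i.
have Bv i : Z2R B *m v i = mu i *: v i.
  rewrite {1}(coordE linj v_neq0 Av (Z2R B *m v i)) (bigD1 i) //= big1 ?addr0 // => j ji.
  have : crd (Z2R A *m (Z2R B *m v i)) j = l i * crd (Z2R B *m v i) j.
    by rewrite mulmxA -ZtoRM mulmxE -BA -mulmxE ZtoRM -mulmxA Av -scalemxAr coordZ.
  rewrite (coord_eigen linj v_neq0 Av _ _ Av) => /eqP; rewrite -subr_eq0 -mulrBl mulf_eq0 subr_eq0.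
  by rewrite (inj_eq linj) (negPf ji) => /eqP ->; rewrite scale0r.
have mu0 i : 0 < mu i.
  have := root_char_poly_eigen (v_neq0 i) (Bv i).
  by rewrite cB !rootM !root_XsubC => /orP[/orP[]|] /eqP ->.
have detE : (\det B)%:~R = mu 0 * mu 1 * mu i2.
  by rewrite -det_ZtoR; apply: (det_eigen linj v_neq0 Av).
have d1 : \det B = 1.
  have : 0 < (\det B)%:~R :> R by rewrite detE !mulr_gt0.
  by move: Bu; rewrite unitmxE ltr0z => /orP[] /eqP ->.
by exists mu; split=> //; rewrite -detE d1.
Qed.

Lemma unit_inv B mu : uact B mu -> [/\ Z2R B *m Z2R (invmx B) = 1%:M,
  Z2R (invmx B) *m Z2R B = 1%:M, \det (Z2R B) = 1 &
  forall x, S x -> S (Z2R (invmx B) *m x)].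
Proof.
move=> [[Bu _ _] dB Bv mu0 _].
have e1 : Z2R B *m Z2R (invmx B) = 1%:M by rewrite -ZtoRM mulmxV // ZtoR_scalar.
have e2 : Z2R (invmx B) *m Z2R B = 1%:M by rewrite -ZtoRM mulVmx // ZtoR_scalar.
split=> //; first by rewrite det_ZtoR dB.
move=> x Sx; apply: kleinP; first by apply: int_mul; case: Sx.
move=> i; rewrite -(pmulr_rgt0 _ (mu0 i)) -(coord_eigen linj v_neq0 Av _ _ Bv).
by rewrite mulmxA e1 mul1mx klein_pos.
Qed.

Lemma edge_unit B mu a b k l' : uact B mu -> edge_datum K a b k l' ->
  edge_datum K (Z2R B *m a) (Z2R B *m b) (Z2R B *m k) (Z2R B *m l').
Proof.
move=> Bmu; have [e1 e2 d1 Si] := unit_inv Bmu.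
apply: (edge_map klein_dbl klein_open e1 e2 d1) => // x; exact: klein_unit Bmu.
Qed.

Lemma klein_int x : S x -> int_pt x. Proof. by case. Qed.

(* A vertex a whose coordinates all exceed those of an integer point e is the midpoint
   of a + e and a - e; so a vertex balanced by a unit lies in a fixed box. *)
Lemma vertices_finite : exists E : seq vec, forall a b k l', edge_datum K a b k l' ->
  exists B mu, uact B mu /\ Z2R B *m a \in E.
Proof.
have [C C0 hC] := unit_balanced Airr lpos linj v_neq0 Av.
have [c c0 hc] := norm_coord.
pose e : vec := delta_mx 0 0.
pose k := \sum_i `|crd e i|.
have ek i : `|crd e i| <= k by rewrite /k (bigD1 i) //= lerDl sumr_ge0.
have [E hE] := int_box_finite (c * \sum_(i < 3) (C * k)).
exists E => a b x y Ed; have [Sa _ _] := edge_S klein_dbl klein_open Ed.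
have [B [mu [Bmu hmu]]] := hC (crd a) (fun i => klein_pos i Sa).
exists B, mu; split=> //; have SBa := klein_unit Bmu Sa.
have [_ _ Bv _ _] := Bmu.
have EB := edge_unit Bmu Ed.
have Vx := edge_vertex klein_int klein_dbl klein_open klein_supp_bound EB.
have [i hi] : exists i, crd (Z2R B *m a) i <= k.
  apply: contrapT => no.
  have big i : k < crd (Z2R B *m a) i by rewrite ltNge; apply/negP => h; apply: no; exists i.
  have bound i := le_lt_trans (ek i) (big i).
  have /eqP : e = 0.
    apply: (vertex_not_midpoint Vx); apply: kleinP.
    - by apply: int_ptD; [case: SBa|exact: delta_int].
    - by move=> i; have := bound i; rewrite coordD ltr_norml; lra.
    - by apply: int_ptD; [case: SBa|apply/int_ptN/delta_int].
    - by move=> i; have := bound i; rewrite coordD coordN ltr_norml; lra.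
  by move/eqP/colP/(_ 0)/eqP; rewrite !mxE !eqxx oner_eq0.
apply: hE; first by case: SBa.
move=> r; apply: le_trans (hc _ _) _; rewrite ler_pM2l //; apply: ler_sum => j _.
rewrite gtr0_norm ?klein_pos //; have := hmu j i.
rewrite -!(coord_eigen linj v_neq0 Av _ _ Bv) => h; apply: le_trans h _.
by rewrite ler_pM2l.
Qed.

(** [B1] contracts directions 1 and 2 and expands 0; [B2] contracts 0 and 2. For m > 0 the product
    contracts direction 2 if n is nonnegative and expands direction 0 if n is negative; inverting
    the relation handles m < 0. *)
Lemma units_independent : exists B1 B2,
  [/\ pos_dirichlet R A B1, pos_dirichlet R A B2 &
      forall m n : int, B1 ^ m * B2 ^ n = 1 -> m = 0 /\ n = 0].
Proof.
have half_gt0 : 0 < 2^-1 :> R by rewrite invr_gt0.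
have [B1 [mu [B1mu hmu]]] := unit_small 0 half_gt0.
have [B2 [nu [B2nu hnu]]] := unit_small 1 half_gt0.
have [P1 d1 B1v mu0 mu1] := B1mu; have [P2 d2 B2v nu0 nu1] := B2nu.
exists B1, B2; split=> //.
have expE B k i (n : int) : uact B k -> Z2R (B ^ n) *m v i = k i ^ n *: v i.
  move=> [[Bu _ _] dB Bv k0 _].
  have pow C r (m : nat) : Z2R C *m v i = r *: v i -> Z2R (C ^+ m) *m v i = r ^+ m *: v i.
    move=> Cv; elim: m => [|m IH]; first by rewrite !expr0 scale1r ZtoR_scalar mul1mx.
    by rewrite !exprS -mulmxE ZtoRM -mulmxA IH -scalemxAr Cv scalerA mulrC.
  have Biv : Z2R B^-1 *m v i = (k i)^-1 *: v i.
    apply: (scalerI (lt0r_neq0 (k0 i))); rewrite scalerA divff ?scale1r ?gt_eqF //.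
    by rewrite scalemxAr -Bv mulmxA -ZtoRM mulVmx // ZtoR_scalar mul1mx.
  by case: n => m; [exact: pow|rewrite /exprz -!exprVn; exact: pow].
have lt1 (x : R) (n : int) : 0 < x -> x < 1 -> 0 < n -> x ^ n < 1.
  by case: n => [[|n]|] // x0 x1 _; rewrite -exprnP exprn_ilt1 // ltW.
have gt1 (x : R) (n : int) : 1 < x -> 0 < n -> 1 < x ^ n.
  by case: n => [[|n]|] // x1 _; rewrite -exprnP exprn_egt1.
have [mu0_0 mu0_2 nu0_0 nu0_2] : [/\ 1 < mu 0, mu i2 < 1, nu 0 < 1 & nu i2 < 1].
  have h1 := hmu 1 isT; have h2 := hmu i2 isT; have h3 := hnu 0 isT; have h4 := hnu i2 isT.
  split; try lra.
  have : mu 1 * mu i2 <= 2^-1 * 2^-1 by rewrite ler_pM // ltW.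
  move=> h; rewrite ltNge; apply/negP => le1.
  have : mu 0 * (mu 1 * mu i2) <= 1 * (2^-1 * 2^-1).
    by rewrite ler_pM // ?mulr_ge0 // ltW.
  by rewrite mulrA mu1; lra.
pose E (m n : int) := mu 0 ^ m * nu 0 ^ n = 1 /\ mu i2 ^ m * nu i2 ^ n = 1.
have EN m n : E m n -> E (- m) (- n).
  by move=> [h h']; split; rewrite -!invr_expz -invfM ?h ?h' invr1.
have Em m n : E m n -> 0 < m -> False.
  move=> [h h'] m0; have [n0|n0] := leP 0 n.
    have a := lt1 _ _ (mu0 i2) mu0_2 m0.
    have b : nu i2 ^ n <= 1.
      have [->|n1] := eqVneq n 0; first by rewrite expr0z.
      by rewrite ltW // lt1 // lt_def n1.
    have : mu i2 ^ m * nu i2 ^ n < 1.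
      apply: le_lt_trans a; rewrite ler_piMr //; exact: ltW (exprz_gt0 _ (mu0 i2)).
    by rewrite h' ltxx.
  have a := gt1 _ _ mu0_0 m0.
  have b : 1 < nu 0 ^ n.
    have := lt1 _ (- n) (nu0 0) nu0_0; rewrite oppr_gt0 -invr_expz => /(_ n0).
    by rewrite invf_lt1 // exprz_gt0.
  by have := mulr_egt1 a b; rewrite h ltxx.
have En n : E 0 n -> 0 < n -> False.
  by move=> [_ h] n0; have := lt1 _ _ (nu0 i2) nu0_2 n0; rewrite -h expr0z mul1r ltxx.
move=> m n h.
have Emn : E m n.
  have eq i : mu i ^ m * nu i ^ n = 1.
    have : Z2R (B1 ^ m * B2 ^ n) *m v i = v i.
      by rewrite h ZtoR_scalar mul1mx.
    rewrite -mulmxE ZtoRM -mulmxA (expE _ _ _ _ B2nu) -scalemxAr (expE _ _ _ _ B1mu) scalerA.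
    rewrite -[RHS]scale1r => /eqP; rewrite -subr_eq0 -scalerBl scaler_eq0 (negPf (v_neq0 i)) orbF subr_eq0.
    by move/eqP; rewrite mulrC.
  by split.
have m0 : m = 0.
  apply/eqP; rewrite eq_le !leNgt; apply/andP; split; apply/negP => m0.
    exact: Em Emn m0.
  by apply: (Em _ _ (EN _ _ Emn)); rewrite oppr_gt0.
split=> //; rewrite m0 in Emn.
apply/eqP; rewrite eq_le !leNgt; apply/andP; split; apply/negP => n0.
  exact: En Emn n0.
have := EN _ _ Emn; rewrite oppr0 => /En; apply; by rewrite oppr_gt0.
Qed.

(** * Rationality and a common denominator *)

Lemma det3_int x y z : int_pt x -> int_pt y -> int_pt z -> det3 x y z \is a Num.int.
Proof. by move=> hx hy hz; rewrite !vE; repeat (apply: rpredB || apply: rpredD || apply: rpredM). Qed.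

Lemma dot_int x y : int_pt x -> int_pt y -> dot x y \is a Num.int.
Proof. by move=> hx hy; rewrite !vE; repeat (apply: rpredD || apply: rpredM). Qed.

Lemma omega_fraction a b k l' : edge_datum K a b k l' ->
  exists m n : int, n != 0 /\ n%:~R * omega a b k l' = m%:~R.
Proof.
move=> Ed; have [Sa Sb _] := edge_S klein_dbl klein_open Ed.
have [k0 [l0 [Sk Sl Ed']]] := edge_int klein_dbl klein_open Ed.
rewrite (edge_omega_uniq klein_dbl klein_open Ed Ed').
have [N1 [N2 [_ _ [_ _ D1] [_ _ D2]]]] := edge_flags klein_dbl klein_open Ed'.
have [a_int _ _] := Sa; have [b_int _ _] := Sb; have [k_int _ _] := Sk; have [l_int _ _] := Sl.
have /intrP [n en] : det3 a b k0 * det3 a b l0 \is a Num.int by rewrite rpredM ?det3_int.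
have /intrP [m em] : det3 (b - a) (k0 - a) (l0 - a) \is a Num.int.
  by apply: det3_int; apply: int_ptD => //; exact: int_ptN.
have n0 : det3 a b k0 * det3 a b l0 != 0 by rewrite mulf_neq0 ?(lt0r_neq0 D1) ?(ltr0_neq0 D2).
exists m, n; split; first by rewrite -(intr_eq0 R) -en.
by rewrite /omega -en -em mulrC divfK.
Qed.

(* Modulo the unit group there are finitely many edges, and omega is invariant. *)
Lemma omega_denominator : exists2 D : int, D != 0 & forall a b k l', edge_datum K a b k l' ->
  exists z : int, D%:~R * omega a b k l' = z%:~R.
Proof.
have [E hE] := vertices_finite.
have nbr a := edge_neighbours klein_int klein_dbl klein_open klein_supp_bound a.
(* Writing the denominator as [D.+1] keeps it nonzero. *)
pose P (ab : vec * vec) (D : nat) := forall k l', edge_datum K ab.1 ab.2 k l' ->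
  exists z : int, D.+1%:Z%:~R * omega ab.1 ab.2 k l' = z%:~R.
have Pex ab : exists D, P ab D.
  have [[k [l' Ed]]|no] := pselect (is_edge K ab.1 ab.2); last first.
    by exists 0%N => k l' Ed; case: no; exists k, l'.
  have [m [n [n0 e]]] := omega_fraction Ed.
  exists (absz n).-1 => k' l'' Ed'; rewrite prednK ?absz_gt0 //.
  rewrite (edge_omega_uniq klein_dbl klein_open Ed' Ed).
  have [s es] : exists s : int, (absz n)%:Z = s * n.
    by have [n_ge0|n_lt0] := leP 0 n; [exists 1|exists (-1)]; lia.
  by exists (s * m); rewrite es !intrM -e mulrA.
have Pmul ab D D' : P ab D -> P ab (D.+1 * D'.+1).-1.
  move=> h k l' /h [z ez]; rewrite prednK // PoszM mulrC.
  by exists (z * D'.+1%:Z); rewrite [RHS]intrM -ez !intrM; ring.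
have common (s : seq (vec * vec)) : exists D, forall ab, ab \in s -> P ab D.
  elim: s => [|ab s [D hD]]; first by exists 0%N.
  have [D' hD'] := Pex ab; exists (D'.+1 * D.+1).-1 => x; rewrite inE => /predU1P[->|xs].
    exact: Pmul.
  by rewrite mulnC; apply: Pmul; exact: hD.
have /choice [ns hns] : forall a, exists ns : seq vec, forall b, b \in ns <-> is_edge K a b.
  by move=> a; have [s _ hs] := nbr a; exists s.
have [D hD] := common [seq (a, b) | a <- E, b <- ns a].
exists D.+1%:Z => // a b k l' Ed; have [B [mu [Bmu BaE]]] := hE _ _ _ _ Ed.
have EB := edge_unit Bmu Ed; have [_ _ d1 _] := unit_inv Bmu.
have [|z ez] := hD (Z2R B *m a, Z2R B *m b) _ _ _ EB; last first.
  by exists z; rewrite -ez /= omega_map.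
apply/allpairsPdep; exists (Z2R B *m a), (Z2R B *m b); split=> //.
by apply/hns; exists (Z2R B *m k), (Z2R B *m l').
Qed.

(** * Projection to a plane *)

Lemma integer_plane_normal (c : vec) d : c != 0 -> d != 0 -> integer_plane c d ->
  exists c0 p0 t, [/\ int_pt c0, int_pt p0, t != 0, c = t *: c0 & d = t * dot c0 p0].
Proof.
move=> c0 d0 [p0 [u [w [p_int u_int w_int ind h]]]].
have hp := h 0 0; have hu := h 1 0; have hw := h 0 1.
rewrite !scale0r !addr0 in hp; rewrite scale0r scale1r addr0 dotDr hp in hu.
rewrite scale0r scale1r addr0 dotDr hp in hw.
have {}hu : dot c u = 0 by apply: (addrI d); rewrite hu addr0.
have {}hw : dot c w = 0 by apply: (addrI d); rewrite hw addr0.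
have uw0 : cross u w != 0.
  apply/eqP => uw; have [u0|u0] := eqVneq u 0.
    have [] := ind 1 0; first by rewrite u0 scaler0 scale0r addr0.
    by move/eqP; rewrite oner_eq0.
  have [t e] := cross_eq0 u0 uw.
  have [] := ind t (-1); first by rewrite -e scaleN1r subrr.
  by move=> _ /eqP; rewrite oppr_eq0 oner_eq0.
(* [c] is orthogonal to both lattice directions, hence a multiple of the integer vector
   [cross u w]. *)
have [|t e] := cross_eq0 (v := c) uw0.
  have -> : cross (cross u w) c = dot c u *: w - dot c w *: u by apply: vecP; rewrite !vE; ring.
  by rewrite hu hw !scale0r subrr.
exists (cross u w), p0, t; split=> //.
- by apply: ord3P; rewrite crossE rpredB ?rpredM ?u_int ?w_int.
- by apply: contraNneq c0 => t0; rewrite e t0 scale0r.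
- by rewrite -dotZl -e.
Qed.

Lemma cross_sumr (I : Type) (s : seq I) (f : I -> vec) a :
  cross a (\sum_(i <- s) f i) = \sum_(i <- s) cross a (f i).
Proof.
elim/big_rec2: _ => [|i x y _ <-]; first by apply: vecP; rewrite !vE; ring.
by apply: vecP; rewrite !vE; ring.
Qed.

(** The force W at [a], freed of the factor [proj_coef c d a], is parallel to [a] by [edge_balance]
    and lies in the kernel of [dot c]. As [dot c a] is nonzero, it vanishes. *)
Lemma projection_stress (c : vec) d (om : vec -> vec -> R) :
  proper_plane K c d ->
  (forall a b k l', edge_datum K a b k l' -> om a b = omega a b k l') ->
  self_stress K (proj_pt c d) (fun a b => proj_coef c d a * proj_coef c d b * om a b).
Proof.
move=> [c0 d0 cv] omE.
have edge_c a b : is_edge K a b -> dot c a != 0 /\ dot c b != 0.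
  move=> [k [l' Ed]]; have Ed' := edge_sym klein_dbl klein_open Ed.
  have Va := edge_vertex klein_int klein_dbl klein_open klein_supp_bound Ed.
  have Vb := edge_vertex klein_int klein_dbl klein_open klein_supp_bound Ed'.
  by split; apply: cv.
split=> [a b [k [l' Ed]]|a].
  rewrite (omE _ _ _ _ Ed) (omE _ _ _ _ (edge_sym klein_dbl klein_open Ed)) omegaC.
  by congr (_ * _); rewrite mulrC.
have [ns uns nsE] := edge_neighbours klein_int klein_dbl klein_open klein_supp_bound a.
exists ns; split=> //.
have bal := edge_balance klein_int klein_dbl klein_open klein_supp_bound uns nsE (omE a).
(* Properness of the plane yields [dot c a != 0] at vertices, and [a] is known to be one only if it
   has a neighbour. *)
case: ns uns nsE bal => [|b0 ns'] uns nsE bal; first by rewrite big_nil.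
have [ca _] : dot c a != 0 /\ dot c b0 != 0.
  by apply: edge_c; apply/nsE; rewrite mem_head.
set ns := b0 :: ns' in uns nsE bal *.
have termE b : b \in ns -> (proj_coef c d a * proj_coef c d b * om a b) *: (proj_pt c d b - proj_pt c d a)
    = proj_coef c d a *: (om a b *: (b - (dot c b / dot c a) *: a)).
  move=> /nsE /edge_c [_ cb]; apply: vecP; rewrite !mxE /proj_coef; field; by rewrite ca cb d0.
rewrite big_seq (eq_bigr _ termE) -big_seq -scaler_sumr.
set W := \sum_(b <- ns) _.
have [t eW] : exists t, W = t *: a.
  apply: cross_eq0; first by apply: contra ca => /eqP ->; rewrite !vE !mulr0 !addr0.
  rewrite -bal cross_sumr; apply: eq_bigr => b _.
  by apply: vecP; rewrite !vE; ring.
have cW : dot c W = 0.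
  rewrite dot_sumr big1 // => b _; rewrite dotZr dotBr dotZr divfK // subrr mulr0 //.
have -> : W = 0.
  move: cW; rewrite eW dotZr => /eqP; rewrite mulf_eq0 (negPf ca) orbF => /eqP ->.
  by rewrite scale0r.
by rewrite scaler0.
Qed.

Lemma integer_stress (c : vec) d : proper_plane K c d -> integer_plane c d ->
  (forall p, is_vertex K p -> rat_pt (proj_pt c d p)) /\
  exists (lam : R) (s : vec -> vec -> int),
    [/\ lam != 0,
        self_stress K (proj_pt c d) (fun a b => (s a b)%:~R) &
        forall a b k l', edge_datum K a b k l' ->
          proj_coef c d a * proj_coef c d b * omega a b k l' = lam * (s a b)%:~R].
Proof.
move=> pp ip; have [c0 d0 cv] := pp.
have [c' [p0 [t [c'_int p0_int t0 ec ed]]]] := integer_plane_normal c0 d0 ip.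
have e0 : dot c' p0 != 0 by apply: contraNneq d0 => e; rewrite ed e mulr0.
have /intrP [e ee] := dot_int c'_int p0_int.
split.
  move=> p /(vertex_S (S := S)) [p_int _ _] i.
  have /intrP [n en] := dot_int c'_int p_int; have /intrP [m em] := p_int i.
  exists (e%:~R / n%:~R * m%:~R).
  rewrite mxE em ec ed dotZl -mulf_div divff // mul1r ee en.
  by rewrite !rmorphM fmorphV /= !rmorph_int.
have [D D0 hD] := omega_denominator.
(* A stress depends on the edge alone; the choice of [om] removes [k] and [l] and is constrained on
   edges only. *)
pose om_spec (ab : vec * vec) (z : R) := forall k l', edge_datum K ab.1 ab.2 k l' -> z = omega ab.1 ab.2 k l'.
have /choice [om omE] : forall ab : vec * vec, exists z : R, om_spec ab z.
  move=> ab; have [[k [l' Ed]]|no] := pselect (is_edge K ab.1 ab.2); last first.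
    by exists 0 => k l' Ed; case: no; exists k, l'.
  by exists (omega ab.1 ab.2 k l') => k' l'' Ed'; have := edge_omega_uniq klein_dbl klein_open Ed Ed'.
have e1 : e%:~R != 0 :> R by rewrite -ee.
(* [D] clears the lifting coefficient. The scale t cancels in [proj_coef], leaving [dot c' a / e],
   so each of the two projection coefficients takes one factor [e]. *)
have DE0 : D%:~R * e%:~R ^+ 2 != 0 :> R by rewrite mulf_neq0 ?expf_neq0 ?intr_eq0 // -(intr_eq0 R).
pose st a b := proj_coef c d a * proj_coef c d b * om (a, b).
have /choice [s hs] : forall ab : vec * vec, exists z : int, is_edge K ab.1 ab.2 ->
    D%:~R * e%:~R ^+ 2 * st ab.1 ab.2 = z%:~R.
  move=> [a b]; have [[k [l' Ed]]|no] := pselect (is_edge K a b); last by exists 0.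
  have [Sa Sb _] := edge_S klein_dbl klein_open Ed.
  have [a_int _ _] := Sa; have [b_int _ _] := Sb.
  have /intrP [x ex] := dot_int c'_int a_int; have /intrP [y ey] := dot_int c'_int b_int.
  have [z ez] := hD _ _ _ _ Ed; exists (x * y * z) => _ /=.
  rewrite /st (omE (a, b) _ _ Ed) /= !intrM -ez -ex -ey /proj_coef ec ed !dotZl -ee.
  by field; rewrite t0 e0.
exists (D%:~R * e%:~R ^+ 2)^-1, (fun a b => s (a, b)); split; first by rewrite invr_neq0.
  have [sym bal] := projection_stress (om := fun a b => om (a, b)) pp (fun a b => omE (a, b)).
  have edge_s a b : is_edge K a b -> (s (a, b))%:~R = D%:~R * e%:~R ^+ 2 * st a b.
    by move=> Eab; rewrite -(hs (a, b)).
  split=> [a b Eab|a].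
    have Eba : is_edge K b a.
      by have [k [l' Ed]] := Eab; exists l', k; have := edge_sym klein_dbl klein_open Ed.
    by rewrite !edge_s // /st sym.
  have [ns [uns nsE sum0]] := bal a; exists ns; split=> //.
  rewrite big_seq (eq_bigr (fun b => (D%:~R * e%:~R ^+ 2) *: (st a b *: (proj_pt c d b - proj_pt c d a)))).
    by rewrite -big_seq -scaler_sumr sum0 scaler0.
  by move=> b /nsE Eab; rewrite edge_s // scalerA.
move=> a b k l' Ed; rewrite -(hs (a, b)); last by exists k, l'.
by rewrite mulKf // /st (omE (a, b) _ _ Ed).
Qed.

End Klein.

Theorem theorem5p8 (R : realType) (A : 'M[int]_3)
    (l1 l2 l3 : R) (v1 v2 v3 : 'cV[R]_3) (c : 'cV[R]_3) (d : R) :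
  A \in unitmx ->
  irreducible_poly (char_poly (ZtoQ A)) ->
  0 < l1 -> 0 < l2 -> 0 < l3 -> l1 != l2 -> l1 != l3 -> l2 != l3 ->
  v1 != 0 -> v2 != 0 -> v3 != 0 ->
  ZtoR R A *m v1 = l1 *: v1 -> ZtoR R A *m v2 = l2 *: v2 ->
  ZtoR R A *m v3 = l3 *: v3 ->
  let K := klein_hull v1 v2 v3 in
  proper_plane K c d ->
  (* 1. rational, all of the same (strict) sign *)
  [/\ (forall a b k l, edge_datum K a b k l -> is_rat (omega a b k l))
      /\ (exists e : R, (e = 1 \/ e = -1) /\
            forall a b k l, edge_datum K a b k l -> 0 < e * omega a b k l),
  (* 2. doubly periodic *)
      (forall B, pos_dirichlet R A B ->
         forall a b k l, edge_datum K a b k l ->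
           let f := fun x => ZtoR R B *m x in
           edge_datum K (f a) (f b) (f k) (f l) /\
           omega (f a) (f b) (f k) (f l) = omega a b k l)
      /\ (exists B1 B2, [/\ pos_dirichlet R A B1, pos_dirichlet R A B2 &
            forall m n : int, B1 ^ m * B2 ^ n = 1 -> m = 0 /\ n = 0]) &
  (* 3. integer projection plane *)
      integer_plane c d ->
      (forall p, is_vertex K p -> rat_pt (proj_pt c d p)) /\
      exists (lam : R) (s : 'cV[R]_3 -> 'cV[R]_3 -> int),
        [/\ lam != 0,
            self_stress K (proj_pt c d) (fun a b => (s a b)%:~R) &
            forall a b k l, edge_datum K a b k l ->
              proj_coef c d a * proj_coef c d b * omega a b k l
                = lam * (s a b)%:~R]].
Proof.
move=> _ Airr l1_gt0 l2_gt0 l3_gt0 l12 l13 l23 v1_neq0 v2_neq0 v3_neq0 Av1 Av2 Av3 K pp.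
pose l (i : 'I_3) := nth 0 [:: l1; l2; l3] i.
pose v (i : 'I_3) := nth 0 [:: v1; v2; v3] i.
have l_gt0 : forall i, 0 < l i by apply: ord3P.
have l_inj : injective l.
  move=> i j /eqP; move: i j; do 2 (apply: ord3P); rewrite /l //= => /eqP e;
    by move: l12 l13 l23; rewrite ?e ?eqxx.
have v_neq0 : forall i, v i != 0 by apply: ord3P.
have Av : forall i, ZtoR R A *m v i = l i *: v i by apply: ord3P.
have dbl := klein_dbl l_inj v_neq0 Av.
have opn := klein_open Airr l_gt0 l_inj v_neq0 Av.
split.
- split=> [a b k m Ed|].
    have [x [y [y0 e]]] := omega_fraction Airr l_gt0 l_inj v_neq0 Av Ed.
    exists (x%:~R / y%:~R); rewrite rmorphM fmorphV /= !rmorph_int -e mulrC mulKf //.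
    by rewrite intr_eq0.
  exists (-1); split; first by right.
  move=> a b k m /(edge_omega dbl opn) [N1 [N2 [_ _ _ om_lt0]]].
  by rewrite mulN1r oppr_gt0.
- split; last exact: units_independent Airr l_gt0 l_inj v_neq0 Av.
  move=> B /(dirichlet_unit_act l_inj v_neq0 Av) [mu Bmu] a b k m Ed f.
  split; first exact: (edge_unit Airr l_gt0 l_inj v_neq0 Av Bmu Ed).
  have [_ _ det1 _] := unit_inv Airr l_gt0 l_inj v_neq0 Av Bmu.
  exact: omega_map.
- exact: (integer_stress Airr l_gt0 l_inj v_neq0 Av pp).
Qed.
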